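(* Let $T$ be a first-order theory. Then $T$ is rosy if and only if thorn-forking in $T$ satisfies symmetry, i.e. for all tuples $a,b$ and all sets $A$: $tp(a/Ab)$ does not thorn-fork over $A$ if and only if $tp(b/Aa)$ does not thorn-fork over $A$.
   Context: We work in a monster model $\mathcal C^{eq}$ of $T$; tuples may be tuples of imaginaries. Strong dividing: a formula $\delta(x,a)$ strongly divides over $A$ if $tp(a/A)$ is non-algebraic and $\{\delta(x,a')\}_{a'\models tp(a/A)}$ is $k$-inconsistent for some $k\in\mathbb N$. Thorn-dividing (written þ-dividing): $\delta(x,a)$ thorn-divides over $A$ if there is a tuple $c$ such that $\delta(x,a)$ strongly divides over $Ac$. Thorn-forking: a formula thorn-forks over $A$ if it implies a finite disjunction of formulas each of which thorn-divides over $A$; a type thorn-divides (thorn-forks) over $A$ if it contains (implies) a formula that does. Thorn-rank: given a formula $\phi$, a finite set $\Delta$ of formulas in variables $x;y$, a finite set $\Pi$ of formulas in variables $y;z$ ($z$ possibly of infinite length), and a number $k$, define $\operatorname{th}(\phi,\Delta,\Pi,k)$ inductively: (1) it is $\ge 0$ if $\phi$ is consistent; (2) for $\lambda$ limit it is $\ge\lambda$ iff it is $\ge\alpha$ for all $\alpha<\lambda$; (3) it is $\ge\alpha+1$ iff there are $\delta\in\Delta$, $\pi(y;z)\in\Pi$ and parameters $c$ such that (a) $\operatorname{th}(\phi\wedge\delta(x,a),\Delta,\Pi,k)\ge\alpha$ for infinitely many $a\models\pi(y;c)$, and (b) $\{\delta(x,a)\}_{a\models\pi(y;c)}$ is $k$-inconsistent.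 A theory is rosy if all of its thorn-ranks are defined (i.e. ordinal-valued). *)

(* Defs.v *)
From mathcomp Require Import all_boot.
From mathcomp Require Import boolp classical_sets functions cardinality wochoice.

Set Implicit Arguments.
Unset Strict Implicit.
Unset Printing Implicit Defensive.

Local Open Scope classical_set_scope.
Local Open Scope card_scope.

(** * Many-sorted first-order logic *)

Record signature := Signature {
  sorts : Type;
  fsym : Type;
  farity : fsym -> nat;
  fdom : forall f, 'I_(farity f) -> sorts;
  fcod : fsym -> sorts;
  rsym : Type;
  rarity : rsym -> nat;
  rdom : forall r, 'I_(rarity r) -> sorts }.
Arguments fdom {s} f _.
Arguments rdom {s} r _.

(* A context is a sorted family of variables: [V s] is the type of the
   variables of sort [s].  Contexts may be infinite; a finite tuple of variables
   is a context satisfying [finite_ctx]. *)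
Definition ctx (S : signature) := sorts S -> Type.

Definition csum S (V W : ctx S) : ctx S := fun s => (V s + W s)%type.

Definition finite_ctx S (V : ctx S) := finite_set [set: {s : sorts S & V s}].

(* [inr] is the fresh variable, of sort [s]. *)
Definition cext S (V : ctx S) (s : sorts S) : ctx S := fun t => (V t + (s = t))%type.

Inductive term S (V : ctx S) : sorts S -> Type :=
| Var s of V s : term V s
| App f of (forall i, term V (fdom f i)) : term V (fcod f).

Inductive form S (V : ctx S) : Type :=
| FEq s of term V s & term V s
| FRel r of (forall i, term V (rdom r i))
| FNeg of form V
| FAnd of form V & form V
| FEx s of form (cext V s).

Definition ctx_map S (V W : ctx S) := forall s, V s -> W s.

Definition cext_map S (V W : ctx S) (r : ctx_map V W) s :
    ctx_map (cext V s) (cext W s) :=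
  fun t x => match x with inl y => inl (r t y) | inr e => inr e end.

Fixpoint rename_term S (V W : ctx S) (r : ctx_map V W) s (t : term V s) :
    term W s :=
  match t with
  | Var s x => Var (r s x)
  | App f args => App (fun i => rename_term r (args i))
  end.

Fixpoint rename S (V W : ctx S) (r : ctx_map V W) (phi : form V) : form W :=
  match phi with
  | FEq s t u => FEq (rename_term r t) (rename_term r u)
  | FRel p args => FRel (fun i => rename_term r (args i))
  | FNeg psi => FNeg (rename r psi)
  | FAnd psi chi => FAnd (rename r psi) (rename r chi)
  | FEx s psi => FEx (rename (@cext_map S V W r s) psi)
  end.

Record structure (S : signature) := Structure {
  carrier :> sorts S -> Type;
  ifunc : forall f, (forall i, carrier (fdom f i)) -> carrier (fcod f);
  irel : forall r, (forall i, carrier (rdom r i)) -> Prop }.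

(* Assignments of the variables in [V]; for [V] finite these are the tuples of
   elements of [M] whose sorts are prescribed by [V]. *)
Definition asg S (V : ctx S) (M : structure S) := forall s, V s -> M s.

Definition vjoin S (V W : ctx S) (M : structure S) (v : asg V M) (w : asg W M) :
    asg (csum V W) M :=
  fun s x => match x with inl y => v s y | inr z => w s z end.

Definition vext S (V : ctx S) (M : structure S) (v : asg V M) s (m : M s) :
    asg (cext V s) M :=
  fun t x => match x with
             | inl y => v t y
             | inr e => eq_rect s (carrier M) m t e
             end.

Fixpoint eval S (M : structure S) (V : ctx S) (v : asg V M) s (t : term V s) :
    M s :=
  match t with
  | Var s x => v s x
  | App f args => @ifunc S M f (fun i => eval v (args i))
  end.

Fixpoint sat S (M : structure S) (V : ctx S) (phi : form V) : asg V M -> Prop :=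
  match phi with
  | FEq s t u => fun v => eval v t = eval v u
  | FRel r args => fun v => @irel S M r (fun i => eval v (args i))
  | FNeg psi => fun v => ~ sat psi v
  | FAnd psi chi => fun v => sat psi v /\ sat chi v
  | FEx s psi => fun v => exists m : M s, sat psi (vext v m)
  end.

(** * Parameter sets and types *)

Section Types.
Variables (S : signature) (M : structure S).

Definition pset := forall s, set (M s).

Definition elements (A : pset) : set {s : sorts S & M s} :=
  [set p | A (projT1 p) (projT2 p)].

Definition adjoin (A : pset) (V : ctx S) (a : asg V M) : pset :=
  fun s => A s `|` range (a s).

(* The elements of [A] used as constants, so that [form (csum X (params A))] is
   the set of L(A)-formulas in the variables [X], and
   [form (csum X (carrier M))] the set of L(M)-formulas. *)
Definition params (A : pset) : ctx S := fun s => {m : M s | A s m}.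

Definition pval (A : pset) : asg (params A) M := fun s m => sval m.

Definition selfval : asg (carrier M) M := fun s m => m.

Definition realizes (A : pset) (X : ctx S) (p : set (form (csum X (params A))))
    (a : asg X M) :=
  forall phi, p phi -> sat phi (vjoin a (@pval A)).

Definition tp (A : pset) (X : ctx S) (a : asg X M) :
    set (form (csum X (params A))) :=
  [set phi | sat phi (vjoin a (@pval A))].
Arguments tp A {X} a.

Definition inst (X Y : ctx S) (delta : form (csum X Y)) (a : asg Y M) :
    form (csum X (carrier M)) :=
  rename (fun s z => match z with inl x => inl x | inr y => inr (a s y) end) delta.

(** * Monster models *)

Definition card_lt T U (A : set T) (B : set U) := ~ (B #<= A).

Definition small (K : Type) (A : pset) := card_lt (elements A) [set: K].

Definition saturated (K : Type) :=
  forall (A : pset) (X : ctx S) (p : set (form (csum X (params A)))),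
    small K A -> finite_ctx X ->
    (forall q, finite_set q -> q `<=` p -> exists a, realizes q a) ->
    exists a, realizes p a.

Definition automorphism (g : forall s, M s -> M s) :=
  [/\ forall s, bijective (g s),
      forall f args, g _ (@ifunc S M f args) = @ifunc S M f (fun i => g _ (args i))
    & forall r args, @irel S M r args <-> @irel S M r (fun i => g _ (args i))].

Definition elementary_map (A : pset) (h : asg (params A) M) :=
  forall phi : form (params A), sat phi (@pval A) <-> sat phi h.

Definition strongly_homogeneous (K : Type) :=
  forall (A : pset) (h : asg (params A) M),
    small K A -> elementary_map h ->
    exists2 g : forall s, M s -> M s,
      automorphism g & forall s (m : params A s), h s m = g s (sval m).

(** * Thorn-forking *)

(* Inconsistency refers to families indexed by tuples: [k] distinct tuples of
   [D] give inconsistent instances even if [delta] does not depend on [y]. *)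
Definition k_inconsistent (k : nat) (X Y : ctx S) (delta : form (csum X Y))
    (D : set (asg Y M)) :=
  forall a : 'I_k -> asg Y M,
    injective a -> (forall i, D (a i)) ->
    ~ exists x : asg X M, forall i, sat delta (vjoin x (a i)).

Definition strongly_divides (A : pset) (X Y : ctx S) (delta : form (csum X Y))
    (a : asg Y M) :=
  infinite_set [set a' | realizes (tp A a) a'] /\
  exists k, k_inconsistent k delta [set a' | realizes (tp A a) a'].

Definition thorn_divides (A : pset) (X Y : ctx S) (delta : form (csum X Y))
    (a : asg Y M) :=
  exists (Z : ctx S) (c : asg Z M),
    finite_ctx Z /\ strongly_divides (adjoin A c) delta a.

Definition thorn_forks (A : pset) (X : ctx S) (phi : form (csum X (carrier M))) :=
  exists (n : nat) (Y : 'I_n -> ctx S) (delta : forall i, form (csum X (Y i)))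
      (a : forall i, asg (Y i) M),
    (forall i, finite_ctx (Y i) /\ thorn_divides A (delta i) (a i)) /\
    forall x : asg X M, sat phi (vjoin x selfval) ->
      exists i, sat (delta i) (vjoin x (a i)).

Definition type_thorn_forks (A B : pset) (X : ctx S)
    (p : set (form (csum X (params B)))) :=
  exists phi : form (csum X (carrier M)),
    (forall x : asg X M, realizes p x -> sat phi (vjoin x selfval)) /\
    thorn_forks A phi.

Definition thorn_symmetric (K : Type) :=
  forall (X Y : ctx S) (a : asg X M) (b : asg Y M) (A : pset),
    finite_ctx X -> finite_ctx Y -> small K A ->
    (~ type_thorn_forks A (tp (adjoin A b) a) <->
     ~ type_thorn_forks A (tp (adjoin A a) b)).

(** * Thorn-rank *)

(* Ordinals are represented as elements [w] of well-ordered types [W], where [R]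
   is the non-strict order. *)
Section Ordinals.
Variables (W : Type) (R : rel W).
Definition olt v w := ~~ R w v.
Definition ozero w := forall v, R w v.
Definition osucc v w := olt v w /\ forall u, olt u w -> R u v.
Definition olimit w := ~ ozero w /\ forall v, ~ osucc v w.
End Ordinals.

(* [th_ge R phi Delta Pi k w] is the relation th(phi,Delta,Pi,k) >= w.  In the
   successor clause "infinitely many a" is rendered by an infinite set [D] of
   such [a], as required by the positivity condition. *)
Inductive th_ge (W : Type) (R : rel W) (X Y Z : ctx S)
    (phi : form (csum X (carrier M))) (Delta : set (form (csum X Y)))
    (Pi : set (form (csum Y Z))) (k : nat) : W -> Prop :=
| th_ge_zero w of ozero R w &
    (exists x : asg X M, sat phi (vjoin x selfval)) :
    th_ge R phi Delta Pi k w
| th_ge_limit w of olimit R w &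
    (forall v, olt R v w -> th_ge R phi Delta Pi k v) :
    th_ge R phi Delta Pi k w
| th_ge_succ v w (delta : form (csum X Y)) (pi : form (csum Y Z)) (c : asg Z M)
    (D : set (asg Y M)) of
    osucc R v w & Delta delta & Pi pi & infinite_set D &
    D `<=` [set a | sat pi (vjoin a c)] &
    (forall a, D a -> th_ge R (FAnd phi (inst delta a)) Delta Pi k v) &
    k_inconsistent k delta [set a | sat pi (vjoin a c)] :
    th_ge R phi Delta Pi k w.

(* A rank fails to be defined when it is >= every ordinal. *)
Definition th_defined (X Y Z : ctx S) (phi : form (csum X (carrier M)))
    (Delta : set (form (csum X Y))) (Pi : set (form (csum Y Z))) (k : nat) :=
  exists (W : Type) (R : rel W) (w : W),
    well_order R /\ ~ th_ge R phi Delta Pi k w.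

Definition rosy :=
  forall (X Y Z : ctx S) (phi : form (csum X (carrier M)))
      (Delta : set (form (csum X Y))) (Pi : set (form (csum Y Z))) (k : nat),
    finite_ctx X -> finite_ctx Y -> finite_set Delta -> finite_set Pi ->
    th_defined phi Delta Pi k.

End Types.

(** * One-sorted theories *)

Record language := Language {
  lfunc : Type;
  lfarity : lfunc -> nat;
  lrel : Type;
  lrarity : lrel -> nat }.

Definition lsig (L : language) : signature :=
  @Signature unit (lfunc L) (@lfarity L) (fun _ _ => tt) (fun _ => tt)
    (lrel L) (@lrarity L) (fun _ _ => tt).

Coercion lsig : language >-> signature.

Definition sentence (L : language) := form (fun _ : sorts L => void).

Definition models (L : language) (M : structure L) (T : set (sentence L)) :=
  forall phi, T phi -> sat (M := M) phi (fun _ x => match x with end).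

(* A K-saturated and strongly K-homogeneous model, K > |L| + aleph_0. *)
Definition monster (L : language) (T : set (sentence L)) (K : Type)
    (C : structure L) :=
  [/\ inhabited (C tt) /\ models C T,
      [/\ card_lt [set: nat] [set: K],
          card_lt [set: lfunc L] [set: K]
        & card_lt [set: lrel L] [set: K]],
      saturated C K
    & strongly_homogeneous C K].

(** * Imaginaries *)

Section Imaginaries.
Variables (L : language) (C : structure L).

Definition pairctx (n : nat) : ctx L := csum (fun _ => 'I_n) (fun _ => 'I_n).

Definition tuplerel n (E : form (pairctx n)) (a b : 'I_n -> C tt) : Prop :=
  let tval (u : 'I_n -> C tt) : asg (fun _ : sorts L => 'I_n) C :=
    fun s => match s with tt => u end in
  sat E (vjoin (tval a) (tval b)).

(* Formulas without parameters defining an equivalence relation on n-tuples. *)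
Record eqformula := EqFormula {
  eqarity : nat;
  eqform : form (pairctx eqarity);
  eqf_refl : forall a, tuplerel eqform a a;
  eqf_sym : forall a b, tuplerel eqform a b -> tuplerel eqform b a;
  eqf_trans : forall a b c,
    tuplerel eqform a b -> tuplerel eqform b c -> tuplerel eqform a c }.

Inductive eqsort := Home | Quot of eqformula.

(* L^eq: the symbols of [L] on the home sort, and for each [E] a function symbol
   [inr E] for the projection onto the sort [Quot E]. *)
Definition eqsig : signature :=
  @Signature eqsort (lfunc L + eqformula)
    (fun f => match f with inl g => lfarity g | inr E => eqarity E end)
    (fun _ _ => Home)
    (fun f => match f with inl _ => Home | inr E => Quot E end)
    (lrel L) (@lrarity L) (fun _ _ => Home).

Definition eqclass (E : eqformula) :=
  {X : set ('I_(eqarity E) -> C tt) |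
    exists a, X = [set b | tuplerel (eqform E) a b]}.

Definition eqcarrier (s : eqsort) : Type :=
  match s with Home => C tt | Quot E => eqclass E end.

Definition toclass (E : eqformula) (a : 'I_(eqarity E) -> C tt) : eqclass E :=
  exist _ [set b | tuplerel (eqform E) a b] (ex_intro _ a erefl).

Definition eqfunc (f : fsym eqsig) :
    (forall i : 'I_(farity f), eqcarrier (fdom f i)) -> eqcarrier (fcod f) :=
  match f with
  | inl g => @ifunc L C g
  | inr E => @toclass E
  end.

Definition eqstructure : structure eqsig :=
  @Structure eqsig eqcarrier eqfunc (@irel L C).

End Imaginaries.

(* Main.v *)
Require Import Defs.
From mathcomp Require Import all_boot.
From Stdlib Require List.
From mathcomp Require Import boolp classical_sets functions cardinality wochoice.

(* Rank [>= n] is approximated by definable trees of depth [n] in which "infinitely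
   many" becomes "at least N"; by compactness, trees of all depths and all
   branchings exist iff some rank is undefined, and they then yield sequences
   along which each [a_i] is non-algebraic over its own [c_i] and the past.

   If a rank is undefined, take such a sequence [(a_i, c_i)] of length omega, [b]
   satisfying all [delta(x, a_i)], and a realization [(a, c)] over [B b] of the
   formulas true at almost all [(a_i, c_i)], where [B] is the set of all [a_i], [c_i].
   Then [delta(x, a)] thorn-divides over [B], whereas tp(a/Bb) is finitely
   satisfiable in [B] and hence does not thorn-fork over [B].

   Conversely, in a rosy theory no type thorn-forks over its own domain. Suppose
   tp(b/Aa) thorn-forks over [A] but tp(a/Ab) does not. Taking non-forking
   extensions of tp(a/Ab), and of the type over [Aa] of the parameters [e]
   witnessing that tp(b/Aa) thorn-forks, gives copies of [(a, e)] such that, read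
   backwards, each is non-algebraic over the preceding ones; [b] satisfies a
   thorn-dividing instance from every copy, so there are trees of every depth.

   Only saturation is used, transferred to [C^eq] by coding classes by
   representatives. *)

Set Implicit Arguments.
Unset Strict Implicit.
Unset Printing Implicit Defensive.

Local Open Scope classical_set_scope.
Local Open Scope card_scope.

Arguments vjoin {S V W M} v w _ _ /.
Arguments tp {S M} A {X} a _.
Arguments adjoin {S M} A {V} a s _.
Arguments vext {S V M} v {s} m _ _ /.

(** * Finite contexts *)

(** The side parameters [c_i] change from step to step, so the limit is taken of the pairs
    [(a_i, c_i)], and the limit [c] becomes the tuple that witnesses thorn-dividing. Such a limit
    requires one formula [delta], one [k] and one context for all the pairs, whereas a rank mixes
    finitely many formulas: a colouring argument on trees first isolates a single index. In the
    converse direction, forking is linked to algebraicity as follows: an element that avoids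
    thorn-dividing formulas cannot make a non-algebraic [e] algebraic. If [Q(y,x)] had fewer than
    [N] solutions, [e] among them, then this statement, read as a formula in [x], would be
    [N]-inconsistent along the conjugates of [e]. Rosiness is used twice there: for the non-forking
    extension of the type of [e] over its own domain, and for the final contradiction with the
    trees. *)

Lemma finite_typeP T :
  finite_set [set: T] <-> exists l : seq T, forall x, List.In x l.
Proof.
split.
  elim/Pchoice: T => T /finite_seqP[l lE]; exists l => x.
  have : [set` l] x by rewrite -lE.
  rewrite /= ; elim: l {lE} => //= y l IH; rewrite inE => /orP[/eqP->|/IH]; [by left|by
      right].
elim/Pchoice: T => T [l lP]; apply/finite_seqP; exists l.
apply/seteqP; split=> // x _; have := lP x; rewrite /mkset /=.
elim: l {lP} => //= y l IH [->|/IH xl]; rewrite inE ?eqxx //= xl orbT //.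
Qed.

Lemma finite_type_surj T U (f : T -> U) :
  (forall y, exists x, f x = y) -> finite_set [set: T] -> finite_set [set: U].
Proof.
move=> fs Tf; have := finite_image f Tf; congr finite_set.
by apply/seteqP; split=> // y _; have [x <-] := fs y; exists x.
Qed.

Lemma finite_type_inj T U (f : T -> U) :
  injective f -> finite_set [set: U] -> finite_set [set: T].
Proof.
move=> fi Uf.
have [t|nT] := pselect (exists t : T, True); last first.
  apply/finite_typeP; exists [::] => x; exfalso; apply: nT; by exists x.
case: t => t _.
pose g u := if pselect (exists x, f x = u) is left e then sval (cid e) else t.
apply: (@finite_type_surj _ _ g) Uf => x; exists (f x); rewrite /g.
case: pselect => [e|[]]; last by exists x.
by case: cid => y /= /fi.
Qed.

Lemma dep_choice I (F : I -> Type) (P : forall i, F i -> Prop) :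
  (forall i, exists x, P i x) -> exists f : forall i, F i, forall i, P i (f i).
Proof. by move=> H; exists (fun i => sval (cid (H i))) => i; case: cid. Qed.

Lemma finite_type_ord n : finite_set [set: 'I_n].
Proof. exact: finite_finset. Qed.

Lemma finite_type_sigT I (F : I -> Type) : finite_set [set: I] ->
  (forall i, finite_set [set: F i]) -> finite_set [set: {i : I & F i}].
Proof.
move=> /finite_typeP[l lP] FF.
have FF' i : exists m : seq (F i), forall x, List.In x m.
  exact/finite_typeP/FF.
have [m mP] := dep_choice FF'.
apply/finite_typeP.
exists (flatten (map (fun i => map (fun x => existT F i x) (m i)) l)) => -[i x].
have := lP i; elim: l {lP} => //= j l IH [->|/IH il].
  rewrite /cat -/cat; apply/List.in_app_iff; left.
  by apply/List.in_map_iff; exists x.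
by apply/List.in_app_iff; right.
Qed.

(** Holds for every index type because proofs of [s = s] are identified by proof irrelevance. *)
Lemma existT_inj T (V : T -> Type) s (x y : V s) :
  existT V s x = existT V s y -> x = y.
Proof.
by move=> E; have := projT2_eq E; rewrite (Prop_irrelevance (projT1_eq E) erefl).
Qed.

Section Contexts.
Variable S : signature.
Implicit Types V W X Y Z : ctx S.

Lemma finite_csum V W : finite_ctx V -> finite_ctx W -> finite_ctx (csum V W).
Proof.
move=> Vf Wf.
pose F (b : bool) := if b then {s & V s} else {s & W s}.
have : finite_set [set: {b : bool & F b}].
  apply: finite_type_sigT; first exact: finite_finset.
  by case.
apply: (@finite_type_surj _ _ (fun p : {b : bool & F b} => 
  match p with existT b x =>
   (if b as b return F b -> {s & csum V W s}
   then fun x => existT _ (projT1 x) (inl (projT2 x))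
   else fun x => existT _ (projT1 x) (inr (projT2 x))) x end)).
case=> s [v|w].
  by exists (existT F true (existT V s v)).
by exists (existT F false (existT W s w)).
Qed.

Definition cbig (I : Type) (V : I -> ctx S) : ctx S := fun s => {i : I & V i s}.

Lemma finite_cbig I (V : I -> ctx S) : finite_set [set: I] ->
  (forall i, finite_ctx (V i)) -> finite_ctx (cbig V).
Proof.
move=> If Vf.
have := finite_type_sigT If Vf.
apply: (@finite_type_surj _ _ (fun p : {i & {s & V i s}} =>
  existT (cbig V) (projT1 (projT2 p)) (existT _ (projT1 p) (projT2 (projT2 p))))).
by case=> s [i v]; exists (existT (fun i => {s & V i s}) i (existT _ s v)).
Qed.

Lemma finite_csub V (P : forall s, V s -> Prop) :
  finite_ctx V -> finite_ctx (fun s => {v : V s | P s v}).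
Proof.
apply: (@finite_type_inj _ _ (fun p : {s & {v : V s | P s v}} =>
  existT V (projT1 p) (sval (projT2 p)))).
move=> [s [v vP]] [s' [v' vP']] /= E.
have Es : s = s' by case: E.
subst s'.
have {E} Ev := existT_inj E.
by subst v'; rewrite (Prop_irrelevance vP vP').
Qed.

Definition cnil : ctx S := fun _ => void.
Lemma finite_cnil : finite_ctx cnil.
Proof. by apply/finite_typeP; exists [::] => -[]. Qed.

Variable M : structure S.

Definition lft V W (u : asg (csum V W) M) : asg V M := fun s v => u s (inl v).
Definition rgt V W (u : asg (csum V W) M) : asg W M := fun s w => u s (inr w).
Arguments lft {V W} u s _ /.
Arguments rgt {V W} u s _ /.
Definition nilasg : asg cnil M := fun s v => match v with end.

Lemma vjoinK V W (u : asg (csum V W) M) : vjoin (lft u) (rgt u) = u.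
Proof. by apply/functional_extensionality_dep => s; apply/funext => -[]. Qed.

Lemma vjoin_inj V W (v v' : asg V M) (w w' : asg W M) :
  vjoin v w = vjoin v' w' -> v = v' /\ w = w'.
Proof. by move=> E; split; [have := congr1 (@lft V W) E|have := congr1 (@rgt V W) E]. Qed.

(** * Definable relations *)

Lemma eval_rename V W (r : ctx_map V W) s (t : term V s) (w : asg W M) :
  eval w (rename_term r t) = eval (fun s x => w s (r s x)) t.
Proof.
elim: t => [s' x|f args IH] //=; congr (@ifunc S M f _).
by apply: functional_extensionality_dep => i; apply: IH.
Qed.

Lemma sat_rename V W (r : ctx_map V W) (phi : form V) (w : asg W M) :
  sat (rename r phi) w <-> sat phi (fun s x => w s (r s x)).
Proof.
elim: phi W r w => {V} V.
- by move=> s t u W r w /=; rewrite !eval_rename.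
- move=> R args W r w /=; rewrite (_ : (fun _ => _) = (fun i =>
    eval (fun (s : sorts S) (x : V s) => w s (r s x)) (args i))) //.
  by apply: functional_extensionality_dep => i; rewrite eval_rename.
- by move=> p IH W r w /=; rewrite IH.
- by move=> p IH q IH' W r w /=; rewrite IH IH'.
- move=> s p IH W r w /=; split=> -[m H]; exists m; move: H; rewrite IH;
    (rewrite (_ : (fun _ _ => _) = vext (fun s x => w s (r s x)) m) //;
     by apply: functional_extensionality_dep => t;
        apply: functional_extensionality_dep => -[]).
Qed.

Lemma sat_rename_eq V W (r : ctx_map V W) (phi : form V) (v : asg V M) (w : asg W M) :
  (forall s x, w s (r s x) = v s x) -> sat (rename r phi) w <-> sat phi v.
Proof.
move=> E; rewrite sat_rename; suff -> : (fun s x => w s (r s x)) = v by [].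
by apply: functional_extensionality_dep => s; apply/funext => x.
Qed.

(** Formulas are handled through the relations that they define, up to equivalence, so that closure
    lemmas replace the writing and renaming of formulas. *)
Definition definable V (P : asg V M -> Prop) :=
  exists phi : form V, forall v, sat phi v <-> P v.

Lemma definable_ext V (P Q : asg V M -> Prop) :
  (forall v, P v <-> Q v) -> definable P -> definable Q.
Proof. by move=> PQ [phi H]; exists phi => v; rewrite H PQ. Qed.

Lemma definable_not V (P : asg V M -> Prop) :
  definable P -> definable (fun v => ~ P v).
Proof. by move=> [p pP]; exists (FNeg p) => v /=; rewrite pP. Qed.

Lemma definable_and V (P Q : asg V M -> Prop) :
  definable P -> definable Q -> definable (fun v => P v /\ Q v).
Proof. by move=> [p pP] [q qP]; exists (FAnd p q) => v /=; rewrite pP qP. Qed.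

Lemma definable_or V (P Q : asg V M -> Prop) :
  definable P -> definable Q -> definable (fun v => P v \/ Q v).
Proof.
move=> dP dQ; apply: definable_ext (definable_not (definable_and
  (definable_not dP) (definable_not dQ))) => v.
split; last by tauto.
by move=> H; apply: contrapT => nPQ; apply: H; tauto.
Qed.

Lemma definable_sub V W (r : ctx_map V W) (P : asg V M -> Prop) :
  definable P -> definable (fun w : asg W M => P (fun s x => w s (r s x))).
Proof. by move=> [p pP]; exists (rename r p) => w; rewrite sat_rename. Qed.

Lemma definable_ex1 V s (P : asg V M -> M s -> Prop) :
  definable (fun u : asg (cext V s) M =>
     P (fun t x => u t (inl x)) (u s (inr erefl))) ->
  definable (fun v => exists m, P v m).
Proof.
move=> [p pP]; exists (FEx p) => v /=.
by split=> -[m H]; exists m; move: H; rewrite pP.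
Qed.

(** The syntax has no constant for truth, and without any sort there may be no formula at all; hence
    [s0]. Since that sort may be empty, the formula is [~ (p /\ ~ p)] rather than [p]. *)
Lemma definable_true V (s0 : sorts S) : definable (fun _ : asg V M => True).
Proof.
pose p : form V := FEx (FEq (Var (V := cext V s0) (inr erefl)) (Var (inr erefl))).
by exists (FNeg (FAnd p (FNeg p))) => v /=; tauto.
Qed.

Lemma definable_all I V (s0 : sorts S) (P : I -> asg V M -> Prop) :
  finite_set [set: I] -> (forall i, definable (P i)) ->
  definable (fun v => forall i, P i v).
Proof.
move=> /finite_typeP[l lP] dP.
apply: (@definable_ext _ (fun v => forall i, List.In i l -> P i v)).
  by move=> v; split=> H i; [apply: H|move=> _; apply: H].
elim: l {lP} => [|i l IH].
  by apply: definable_ext (definable_true V s0).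
apply: definable_ext (definable_and (dP i) IH) => v /=.
by split=> [[Pi H] j [<-|/H]|H] //; split=> [|j jl]; apply: H; [left|right].
Qed.

(* Eliminates the variables of [Y] one at a time along a list enumerating them. *)
Lemma definable_ex V Y (P : asg V M -> asg Y M -> Prop) :
  finite_ctx Y -> definable (fun u : asg (csum V Y) M => P (lft u) (rgt u)) ->
  definable (fun v => exists y, P v y).
Proof.
move=> /finite_typeP[l lP].
pose Yl (l : seq {s & Y s}) : ctx S := fun s => {y : Y s | List.In (existT Y s y) l}.
suff aux V' (Q : asg V' M -> asg (Yl l) M -> Prop) :
    definable (fun u => Q (lft u) (rgt u)) -> definable (fun v => exists y, Q v y).
  move=> dP; pose r : ctx_map Y (Yl l) := fun s y => exist _ y (lP (existT Y s y)).
  have H := aux V (fun v y => P v (fun s x => y s (r s x)))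
    (definable_sub (W := csum V (Yl l)) (fun s x =>
      match x with inl v => inl v | inr y => inr (r s y) end) dP).
  apply: definable_ext H => v; split=> [[y Py]|[y Py]].
    by exists (fun s x => y s (r s x)).
  by exists (fun s x => y s (sval x)).
elim: l V' Q {lP P} => [|[t y0] l IH] V' Q dQ.
  pose e : asg (Yl [::]) M := fun s x => match svalP x with end.
  have := definable_sub (fun s (x : csum V' (Yl [::]) s) =>
    match x with inl v => v | inr y => match svalP y with end end) dQ.
  apply: definable_ext => v; split=> [H|[y]].
    by exists e; move: H; congr (Q _ _);
      apply: functional_extensionality_dep => s; apply/funext => -[].
  by congr (Q _ _);
      apply: functional_extensionality_dep => s; apply/funext => -[].
(* [y0] may occur again in [l]; equality with [y0] is tested first, so [y0] always goes to the
   quantified variable and its copy in [l] is ignored. *)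
pose r : ctx_map (Yl ((existT _ t y0) :: l)) (csum (fun s => t = s) (Yl l)) :=
  fun s y => match pselect (existT Y t y0 = existT Y s (sval y)) with
  | left e => inl (congr1 (@projT1 _ _) e)
  | right ne => inr (exist _ (sval y)
       (match svalP y with or_introl e => False_ind _ (ne e) | or_intror h => h end))
  end.
pose ju (m : M t) (y : asg (Yl l) M) : asg (Yl (existT _ t y0 :: l)) M :=
  fun s x => match r s x with
             | inl e => eq_rect t (carrier M) m s e | inr z => y s z end.
apply: (@definable_ext _ (fun v => exists m, exists y, Q v (ju m y))).
  move=> v; split=> [[m [y Qy]]|[y Qy]]; first by exists (ju m y).
  exists (y t (exist _ y0 (or_introl erefl))).
  exists (fun s z => y s (exist _ (sval z) (or_intror (svalP z)))).
  rewrite (_ : ju _ _ = y) //.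
  apply: functional_extensionality_dep => s; apply/funext => -[z zP].
  rewrite /ju /r /=; case: pselect => [e|ne] /=.
    have Es : t = s by case: e.
    subst s; have Ez := existT_inj e; subst z.
    rewrite (Prop_irrelevance (congr1 _ _) erefl) /=.
    by congr (y t _); exact: eq_exist.
  by congr (y s _); exact: eq_exist.
apply: definable_ex1.
pose r2 : ctx_map (csum V' (Yl (existT _ t y0 :: l))) (csum (cext V' t) (Yl l)) :=
  fun s x => match x with
    | inl v => inl (inl v)
    | inr y => match r s y with inl e => inl (inr e) | inr z => inr z end end.
have dQ2 := definable_sub r2 dQ.
apply: (IH (cext V' t) (fun (u : asg (cext V' t) M) y => Q (fun s x => u s (inl x)) 
  (ju (u t (inr erefl)) y))).
apply: definable_ext dQ2 => w.
rewrite (_ : rgt _ = ju (lft w t (inr erefl)) (rgt w)) //.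
apply: functional_extensionality_dep => s; apply/funext => y.
rewrite /rgt /ju /r2 /=; case: (r s y) => [e|z] //=.
by subst s.
Qed.

End Contexts.

Arguments lft {S M V W} u s _ /.
Arguments rgt {S M V W} u s _ /.
Arguments cnil {S}.

(** * Finite support of formulas in infinite contexts *)

Section Support.
Variable S : signature.
Implicit Types V W X Y Z : ctx S.

(** Shrinks [V] to the finitely many variables that [r] hits and keeps [Q] whole: [Q] will be a
    bound variable, or the free variables to be preserved when only parameters are cut down. *)
Lemma ctx_map_split V Q W (r : ctx_map W (csum V Q)) : finite_ctx W ->
  exists W' (r' : ctx_map W' V) (t : ctx_map W (csum W' Q)), finite_ctx W' /\
  forall s w, r s w = match t s w with inl w' => inl (r' s w') | inr q => inr q end.
Proof.
move=> Wf.
exists (fun s => {p : V s | exists w, r s w = inl p}), (fun s => @sval _ _).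
exists (fun s w => match r s w as z return r s w = z -> _ with
   | inl p => fun e => inl (exist _ p (ex_intro _ w e)) | inr q => fun _ => inr q end
       erefl).
split; last first.
  move=> s w; move: (erefl (r s w)).
  by case: {2 3 4}(r s w).
pose W0 := fun s => {w : W s | exists p, r s w = inl p}.
have W0f : finite_ctx W0 by apply: finite_csub.
pose f (p : {s & W0 s}) : {s & {p : V s | exists w, r s w = inl p}} :=
  existT _ (projT1 p) (exist _ (sval (cid (svalP (projT2 p))))
    (ex_intro _ (sval (projT2 p)) (svalP (cid (svalP (projT2 p)))))).
apply: (@finite_type_surj _ _ f) W0f => -[s [p pP]].
have [w wp] := pP.
exists (existT W0 s (exist _ w (ex_intro _ p wp))); rewrite /f /=.
congr existT; apply: eq_exist => /=; case: cid => q /= qP.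
by rewrite wp in qP; case: qP.
Qed.

Variable M : structure S.

Lemma term_support V s (t : term V s) :
  exists W (r : ctx_map W V) (t' : term W s), finite_ctx W /\
  forall v : asg V M, eval v t = eval (fun s x => v s (r s x)) t'.
Proof.
elim: t => [s' x|f args IH].
  exists (fun t => s' = t), (fun t e => eq_rect s' V x t e), (Var (V := fun t => s' =
      t) erefl).
  split=> //; apply/finite_typeP; exists [:: existT _ s' erefl] => -[t e].
  by subst t; left.
have {IH} := IH => /dep_choice[W /dep_choice[r /dep_choice[t' H]]].
exists (cbig W), (fun s x => r (projT1 x) s (projT2 x)).
exists (App (fun i => rename_term (W := cbig W) (fun s x => existT (fun i => W i s) i
    x) (t' i))).
split; first by apply: finite_cbig => [|i]; [exact: finite_type_ord|have [] := H i].
move=> v /=; congr (@ifunc S M f _).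
by apply: functional_extensionality_dep => i; rewrite eval_rename; have [_ ->] := H i.
Qed.

(** Induction on the formula. Under a quantifier the support may contain the bound variable, which
    [ctx_map_split] sets apart so that it can be quantified again. *)
Lemma form_support V (phi : form V) :
  exists W (r : ctx_map W V) (phi' : form W), finite_ctx W /\
  forall v : asg V M, sat phi v <-> sat phi' (fun s x => v s (r s x)).
Proof.
elim: phi => {V} V.
- move=> s t u.
  have [W [r [t' [Wf tE]]]] := term_support t.
  have [W' [r' [u' [W'f uE]]]] := term_support u.
  exists (csum W W'), (fun s x => match x with inl w => r s w | inr w => r' s w end).
  exists (FEq (rename_term (W := csum W W') (fun s => inl) t')
              (rename_term (W := csum W W') (fun s => inr) u')).
  split; first exact: finite_csum.
  by move=> v /=; rewrite !eval_rename tE uE.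
- move=> R args.
  have /dep_choice[W /dep_choice[r /dep_choice[t' H]]] := fun i => term_support (args i).
  exists (cbig W), (fun s x => r (projT1 x) s (projT2 x)).
  exists (FRel (fun i => rename_term (W := cbig W) (fun s x => existT (fun i => W i s)
      i x) (t' i))).
  split; first by apply: finite_cbig => [|i]; [exact: finite_type_ord|have [] := H i].
  move=> v /=; rewrite (_ : (fun _ => _) = (fun i => eval (fun (s : sorts S) (x : cbig
      W s) => v s (r (projT1 x) s (projT2 x)))
        (rename_term (fun (s0 : sorts S) (x : W i s0) => existT (fun i0 => W i0 s0) i
            x) (t' i)))) //.
  by apply: functional_extensionality_dep => i; rewrite eval_rename; have [_ ->] := H i.
- move=> p [W [r [p' [Wf pE]]]]; exists W, r, (FNeg p'); split=> // v /=.
  by rewrite pE.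
- move=> p [W [r [p' [Wf pE]]]] q [W' [r' [q' [W'f qE]]]].
  exists (csum W W'), (fun s x => match x with inl w => r s w | inr w => r' s w end).
  exists (FAnd (rename (W := csum W W') (fun s => inl) p')
              (rename (W := csum W W') (fun s => inr) q')).
  split; first exact: finite_csum.
  by move=> v /=; rewrite !sat_rename pE qE.
move=> s p [W [r [p' [Wf pE]]]].
have [W' [r' [t [W'f tE]]]] := @ctx_map_split V (fun t => s = t) W r Wf.
exists W', r', (FEx (rename (W := cext W' s) t p')); split=> // v /=.
have E (m : M s) : (fun s0 x => vext v m s0 (r s0 x)) =
    (fun s0 x => vext (fun s1 y => v s1 (r' s1 y)) m s0 (t s0 x)).
  apply: functional_extensionality_dep => s'; apply/funext => w.
  by rewrite tE; case: (t s' w).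
by split=> -[m H]; exists m; move: H; rewrite pE sat_rename E.
Qed.

End Support.

(** * Definability with parameters *)

Section DefO.
Variables (S : signature) (M : structure S) (s0 : sorts S).
Implicit Types (V W X Y Z : ctx S) (A B : pset M).

Definition pdefinable B X (P : asg X M -> Prop) :=
  exists Q : asg (csum X (params B)) M -> Prop, definable Q /\
    forall x, P x <-> Q (vjoin x (@pval S M B)).

Lemma pdefinable_formP B X (P : asg X M -> Prop) :
  pdefinable B P <-> exists phi : form (csum X (params B)),
    forall x, P x <-> sat phi (vjoin x (@pval S M B)).
Proof.
split=> [[Q [[phi pE] PQ]]|[phi pE]].
  by exists phi => x; rewrite PQ pE.
by exists (sat phi); split=> //; exists phi.
Qed.

Lemma pdefinable_ext B X (P Q : asg X M -> Prop) :
  (forall x, P x <-> Q x) -> pdefinable B P -> pdefinable B Q.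
Proof. by move=> PQ [R [dR PR]]; exists R; split=> // x; rewrite -PQ. Qed.

Lemma pdefinable_not B X (P : asg X M -> Prop) : pdefinable B P -> pdefinable B (fun x
    => ~ P x).
Proof.
move=> [R [dR PR]]; exists (fun u => ~ R u).
by split=> [|x]; [exact: definable_not|rewrite PR].
Qed.

Lemma pdefinable_and B X (P Q : asg X M -> Prop) :
  pdefinable B P -> pdefinable B Q -> pdefinable B (fun x => P x /\ Q x).
Proof.
move=> [R [dR PR]] [R' [dR' PR']]; exists (fun u => R u /\ R' u).
by split=> [|x]; [exact: definable_and|rewrite PR PR'].
Qed.

Lemma pdefinable_or B X (P Q : asg X M -> Prop) :
  pdefinable B P -> pdefinable B Q -> pdefinable B (fun x => P x \/ Q x).
Proof.
move=> [R [dR PR]] [R' [dR' PR']]; exists (fun u => R u \/ R' u).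
by split=> [|x]; [exact: definable_or|rewrite PR PR'].
Qed.

Lemma pdefinable_cst B X (p : Prop) : pdefinable B (fun _ : asg X M => p).
Proof.
exists (fun _ => p); split=> //.
have [hp|hp] := pselect p.
  by apply: definable_ext (definable_true _ _ s0).
apply: definable_ext (definable_not (definable_true M _ s0)); tauto.
Qed.

Lemma pdefinable_imp B X (P Q : asg X M -> Prop) :
  pdefinable B P -> pdefinable B Q -> pdefinable B (fun x => P x -> Q x).
Proof.
move=> dP dQ; apply: pdefinable_ext (pdefinable_or (pdefinable_not dP) dQ) => x.
by have [h|h] := pselect (P x); tauto.
Qed.

Lemma pdefinable_all I B X (P : I -> asg X M -> Prop) :
  finite_set [set: I] -> (forall i, pdefinable B (P i)) ->
  pdefinable B (fun x => forall i, P i x).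
Proof.
move=> If /dep_choice[R H]; exists (fun u => forall i, R i u); split.
  by apply: definable_all => // i; have [] := H i.
by move=> x; split=> h i; have [_ hi] := H i; apply/hi.
Qed.

Lemma pdefinable_exi I B X (P : I -> asg X M -> Prop) :
  finite_set [set: I] -> (forall i, pdefinable B (P i)) ->
  pdefinable B (fun x => exists i, P i x).
Proof.
move=> If dP; apply: pdefinable_ext (pdefinable_not (pdefinable_all If (fun i =>
    pdefinable_not (dP i)))) => x.
by split=> [/existsNP[i /contrapT]|[i Pi] /(_ i)] //; exists i.
Qed.

Lemma pdefinable_subst B X X' (r : ctx_map X (csum X' (params B))) (P : asg X M -> Prop) :
  pdefinable B P -> pdefinable B (fun x' => P (fun s v => vjoin x' (@pval S M B) s (r s
      v))).
Proof.
move=> [R [dR PR]].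
pose r' : ctx_map (csum X (params B)) (csum X' (params B)) := fun s v =>
  match v with inl x => r s x | inr p => inr p end.
exists (fun u => R (fun s v => u s (r' s v))); split; first exact: definable_sub.
move=> x; rewrite PR (_ : vjoin _ _ =
   (fun s v => vjoin x (@pval S M B) s (r' s v))) //.
by apply: functional_extensionality_dep => s; apply/funext => -[].
Qed.

Lemma pdefinable_sub B X X' (r : ctx_map X X') (P : asg X M -> Prop) :
  pdefinable B P -> pdefinable B (fun x' => P (fun s v => x' s (r s v))).
Proof. exact: (@pdefinable_subst B X X' (fun s v => inl (r s v))). Qed.

Lemma pdefinable_inst B X Y (P : asg X M -> asg Y M -> Prop) (e : asg Y M) :
  (forall s y, B s (e s y)) ->
  pdefinable B (fun u : asg (csum X Y) M => P (lft u) (rgt u)) ->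
  pdefinable B (fun x => P x e).
Proof.
move=> eB; apply: (@pdefinable_subst B (csum X Y) X (fun s v =>
  match v with inl x => inl x | inr y => inr (exist _ (e s y) (eB s y)) end)).
Qed.

Lemma pdefinable_ex B X Y (P : asg X M -> asg Y M -> Prop) : finite_ctx Y ->
  pdefinable B (fun u : asg (csum X Y) M => P (lft u) (rgt u)) ->
  pdefinable B (fun x => exists y, P x y).
Proof.
move=> Yf [R [dR PR]].
exists (fun v => exists y, R (vjoin (vjoin (lft v) y) (rgt v))); split.
  apply: (definable_ex (V := csum X (params B))
    (P := fun v y => R (vjoin (vjoin (lft v) y) (rgt v)))) => //.
  have := definable_sub (W := csum (csum X (params B)) Y) (fun s v =>
    match v with inl (inl x) => inl (inl x) | inl (inr y) => inr y
    | inr p => inl (inr p) end) dR.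
  apply: definable_ext => u.
  rewrite (_ : vjoin _ _ = (fun s v => u s
     match v with inl (inl x) => inl (inl x) | inl (inr y) => inr y
     | inr p => inl (inr p) end)) //.
  by apply: functional_extensionality_dep => s; apply/funext => -[[]|].
by move=> x; split=> -[y H]; exists y; move: H; rewrite (PR (vjoin x y)).
Qed.

Lemma pdefinable_sat B X (phi : form X) : pdefinable B (fun x : asg X M => sat phi x).
Proof.
exists (fun u => sat phi (lft u)); split=> //.
apply: definable_sub; by exists phi.
Qed.

Lemma pdefinable_eq B X s (v w : X s) : pdefinable B (fun x : asg X M => x s v = x s w).
Proof. exact: (@pdefinable_sat B X (FEq (Var v) (Var w))). Qed.

Lemma pdefinable_mono A B X (P : asg X M -> Prop) :
  (forall s, A s `<=` B s) -> pdefinable A P -> pdefinable B P.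
Proof.
move=> AB [R [dR PR]].
exists (fun u => R (vjoin (lft u) (fun s (p : params A s) => u s (inr (exist _ (sval p)
    (AB s _ (svalP p))))))).
split.
  have := definable_sub (W := csum X (params B)) (fun s v => match v with
    inl x => inl x | inr p => inr (exist _ (sval p) (AB s _ (svalP p))) end) dR.
  apply: definable_ext => u.
  suff -> : vjoin (lft u) (fun s (p : params A s) =>
      u s (inr (exist _ (sval p) (AB s _ (svalP p))))) =
    (fun s v => u s (match v with inl x => inl x
      | inr p => inr (exist _ (sval p) (AB s _ (svalP p))) end)) by [].
  by apply: functional_extensionality_dep => s; apply/funext => -[].
by [].
Qed.

(** A parameter of [adjoin A c] is traced back to [A] or to an entry of [c], whichever [f] picks,
    and in the second case becomes a variable. *)
Lemma pdefinable_adjoin A X Z (c : asg Z M) (P : asg X M -> Prop) :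
  pdefinable (adjoin A c) P ->
  exists Q : asg X M -> asg Z M -> Prop,
    pdefinable A (fun u : asg (csum X Z) M => Q (lft u) (rgt u)) /\
    forall x, P x <-> Q x c.
Proof.
move=> [R [dR PR]].
have H s (p : params (adjoin A c) s) :
    exists q : params A s + Z s, sval p = match q with inl a => sval a | inr z => c s z end.
  case: p => m mA; case: (mA) => [Am|[z zT zm]]; first by exists (inl (exist _ m Am)).
  by exists (inr z).
pose f s p := sval (cid (H s p)).
have fP s p : sval p = match f s p with inl a => sval a | inr z => c s z end.
  by rewrite /f; case: cid.
exists (fun x z => R (vjoin x (fun s p => match f s p with inl a => sval a | inr z' =>
    z s z' end))).
split.
  pose r : ctx_map (csum X (params (adjoin A c))) (csum (csum X Z) (params A)) :=
    fun s v => match v with inl x => inl (inl x)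
    | inr p => match f s p with inl a => inr a | inr z => inl (inr z) end end.
  exists (fun u => R (fun s v => u s (r s v))); split; first exact: definable_sub.
  move=> u; rewrite (_ : vjoin _ _ = (fun s v => vjoin u (@pval S M A) s (r s v))) //.
  apply: functional_extensionality_dep => s; apply/funext => -[//|p].
  by rewrite /r /=; case: (f s p).
move=> x; rewrite PR (_ : @pval _ _ _ = fun s p => match f s p with inl a => sval a |
    inr z' => c s z' end) //.
by apply: functional_extensionality_dep => s; apply/funext => p; rewrite -fP.
Qed.

Lemma pdefinable_support B X (P : asg X M -> Prop) : pdefinable B P ->
  exists W (w : asg W M) (Q : asg X M -> asg W M -> Prop),
  [/\ finite_ctx W, forall s x, B s (w s x),
      definable (fun u : asg (csum X W) M => Q (lft u) (rgt u)) &
      forall x, P x <-> Q x w].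
Proof.
move=> [R [[phi phiE] PR]].
have [W [r [phi' [Wf E]]]] := form_support M phi.
have [W' [r' [t [W'f tE]]]] := @ctx_map_split S (params B) X W
  (fun s w => match r s w with inl x => inr x | inr p => inl p end) Wf.
exists W', (fun s w => sval (r' s w)).
exists (fun x w => sat phi' (fun s v => match t s v with inl w' => w s w' | inr y => x
    s y end)).
split=> //; first by move=> s x; exact: svalP.
  pose q : ctx_map W (csum X W') := fun s v =>
    match t s v with inl w => inr w | inr x => inl x end.
  exists (rename q phi') => u; rewrite sat_rename.
  rewrite (_ : (fun _ _ => _) = (fun s v =>
    match t s v with inl w => rgt u s w | inr x => lft u s x end)) //.
  apply: functional_extensionality_dep => s; apply/funext => v.
  by rewrite /q; case: (t s v).
move=> x; rewrite PR -phiE E.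
rewrite (_ : (fun _ _ => vjoin _ _ _ _) = (fun s v => match t s v with
  inl w' => sval (r' s w') | inr y => x s y end)) //.
apply: functional_extensionality_dep => s; apply/funext => v.
by have := tE s v; case: (r s v) => [y|p] /=; case: (t s v) => // z [->].
Qed.

Lemma definable_defO B X (P : asg X M -> Prop) : definable P -> pdefinable B P.
Proof. by move=> [phi pE]; apply: pdefinable_ext (pdefinable_sat B phi). Qed.

Definition many T N (D : T -> Prop) :=
  exists f : 'I_N -> T, injective f /\ forall i, D (f i).

(* An [N]-tuple of elements of [asg Y M] is coded as an assignment of the context
   [cbig (fun _ : 'I_N => Y)]. *)
Lemma pdefinable_exfun N B X Y (P : asg X M -> ('I_N -> asg Y M) -> Prop) :
  finite_ctx Y ->
  pdefinable B (fun u : asg (csum X (cbig (fun _ : 'I_N => Y))) M =>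
    P (lft u) (fun i s y => u s (inr (existT (fun _ : 'I_N => Y s) i y)))) ->
  pdefinable B (fun x => exists f, P x f).
Proof.
move=> Yf dP.
have Zf : finite_ctx (cbig (fun _ : 'I_N => Y)).
  by apply: finite_cbig => //; exact: finite_type_ord.
apply: pdefinable_ext (pdefinable_ex (P := fun x (z : asg (cbig (fun _ : 'I_N => Y)) M) =>
  P x (fun i s y => z s (existT (fun _ : 'I_N => Y s) i y))) Zf dP) => x.
split=> [[z Pz]|[f Pf]]; first by exists (fun i s y => z s (existT (fun _ : 'I_N => Y
    s) i y)).
by exists (fun s z => f (projT1 z) s (projT2 z)).
Qed.

Lemma pdefinable_proj_inj N B X Y : finite_ctx Y ->
  pdefinable B (fun u : asg (csum X (cbig (fun _ : 'I_N => Y))) M =>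
    injective (fun i s y => u s (inr (existT (fun _ : 'I_N => Y s) i y)))).
Proof.
move=> Yf.
apply: (@pdefinable_ext _ _ (fun u => forall p : 'I_N * 'I_N,
  (forall q : {s & Y s}, u (projT1 q) (inr (existT _ p.1 (projT2 q))) =
                         u (projT1 q) (inr (existT _ p.2 (projT2 q)))) -> p.1 = p.2)).
  move=> u; split=> [H i j E|H [i j] /= E].
    by apply: (H (i, j)) => -[s y] /=; have := congr1 (fun f => f s y) E.
  apply: H; apply: functional_extensionality_dep => s; apply/funext => y.
  exact: (E (existT _ s y)).
apply: pdefinable_all => [|[i j]]; first exact: finite_finset.
apply: pdefinable_imp; last exact: pdefinable_cst.
by apply: pdefinable_all => // -[s y] /=; exact: pdefinable_eq.
Qed.

Lemma pdefinable_many N B X Y (P : asg X M -> asg Y M -> Prop) : finite_ctx Y ->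
  pdefinable B (fun u : asg (csum X Y) M => P (lft u) (rgt u)) ->
  pdefinable B (fun x => many N (P x)).
Proof.
move=> Yf dP.
apply: (pdefinable_exfun (P := fun x f => injective f /\ forall i, P x (f i))) => //.
apply: pdefinable_and; first exact: pdefinable_proj_inj.
apply: pdefinable_all => [|i]; first exact: finite_type_ord.
exact: (pdefinable_sub (fun s (v : csum X Y s) => match v with inl x => inl x
  | inr y => inr (existT (fun _ : 'I_N => Y s) i y) end) dP).
Qed.

End DefO.

Section Adjoin.
Variables (S : signature) (M : structure S).
Implicit Types (A B : pset M).

Lemma pset_eq A B : (forall s m, A s m <-> B s m) -> A = B.
Proof.
move=> H; apply: functional_extensionality_dep => s; apply/funext => m.
by apply/propext.
Qed.

Lemma adjoin_vjoin A W Z (w : asg W M) (c : asg Z M) :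
  adjoin (adjoin A w) c = adjoin A (vjoin w c).
Proof.
apply: pset_eq => s m; split=> [[[Am|[x _ E]]|[x _ E]]|[Am|[[x|x] _ E]]].
- by left.
- by right; exists (inl x).
- by right; exists (inr x).
- by left; left.
- by left; right; exists x.
- by right; exists x.
Qed.

Lemma adjoinAC A W Z (w : asg W M) (c : asg Z M) :
  adjoin (adjoin A w) c = adjoin (adjoin A c) w.
Proof. by apply: pset_eq => s m; rewrite /adjoin /setU /mkset; tauto. Qed.

Lemma adjoin_nil A : adjoin A (@nilasg S M) = A.
Proof. by apply: pset_eq => s m; split=> [[|[[]]]|]; [|left]. Qed.

Lemma adjoin_sub A Z (c : asg Z M) s : @A s `<=` adjoin A c s.
Proof. by left. Qed.

Lemma pdefinable_eq_tuple (s0 : sorts S) A Y (e : asg Y M) : finite_ctx Y ->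
  (forall s y, @A s (@e s y)) -> pdefinable A (fun y : asg Y M => y = e).
Proof.
move=> Yf eA; apply: (@pdefinable_inst _ _ _ _ _ (fun y z => y = z)) => //.
apply: (@pdefinable_ext _ _ _ _ (fun u : asg (csum Y Y) M => forall p : {s & Y s},
   u (projT1 p) (inl (projT2 p)) = u (projT1 p) (inr (projT2 p)))).
  move=> u; split=> [H|E [s y]]; last exact: (congr1 (fun g => g s y) E).
  apply: functional_extensionality_dep => s; apply/funext => y.
  exact: (H (existT _ s y)).
by apply: (pdefinable_all s0) => // p; exact: pdefinable_eq.
Qed.

Lemma pdefinable_empty_definable A Y (P : asg Y M -> Prop) :
  (forall s, @A s = set0) -> pdefinable A P -> definable P.
Proof.
move=> A0 [Q [[phi phiE] PQ]].
have no s (p : params A s) : False by case: p => m; rewrite A0.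
exists (rename (fun s v => match v with inl y => y | inr p => match no s p with end
    end) phi) => y.
by rewrite PQ -phiE; apply: sat_rename_eq => s [|p] //; case: (no s p).
Qed.

End Adjoin.

(** * Counting *)

Lemma many_le T m n (D : T -> Prop) : m <= n -> many n D -> many m D.
Proof.
move=> mn [f [fi fD]]; exists (fun i => f (widen_ord mn i)); split=> [i j|i //].
by move=> /fi/(congr1 val)/= E; apply: val_inj.
Qed.

Lemma many_sub T n (D E : T -> Prop) : (forall x, D x -> E x) -> many n D -> many n E.
Proof. by move=> DE [f [fi fD]]; exists f; split=> // i; apply: DE. Qed.

Lemma many1 T (D : T -> Prop) : many 1 D <-> exists x, D x.
Proof.
split=> [[f [_ fD]]|[x Dx]]; first by exists (f ord0).
by exists (fun _ => x); split=> // i j _; rewrite !ord1.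
Qed.

(** If at most [m] of the [m + n] elements satisfy [P], at least [n] others remain, and these
    satisfy [Q]; hence the [m.+1]. *)
Lemma many_split T m n (D P Q : T -> Prop) :
  (forall x, D x -> P x \/ Q x) -> many (m + n) D ->
  many m.+1 (fun x => D x /\ P x) \/ many n (fun x => D x /\ Q x).
Proof.
move=> DPQ [f [fi fD]].
have sub (a : nat) (I : {set 'I_(m + n)}) (R : T -> Prop) :
    (forall i, i \in I -> R (f i)) -> a <= #|I| -> many a (fun x => D x /\ R x).
  move=> IR aI; exists (fun i => f (enum_val (widen_ord aI i))); split.
    by move=> i j /fi/enum_val_inj/(congr1 val)/= E; apply: val_inj.
  by move=> i; split=> //; apply: IR; exact: enum_valP.
pose I : {set _} := finset (fun i => `[< P (f i) >]).
have [mI|mI] := leqP m.+1 #|I|.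
  by left; refine (sub _ I P _ mI) => i; rewrite inE => /asboolP.
right; apply: (sub _ (~: I) Q) => [i|].
  by rewrite !inE => /asboolP nP; have [] := DPQ _ (fD i).
by rewrite -(leq_add2l #|I|) cardsC card_ord leq_add2r.
Qed.

Lemma many_avoid T n (D : T -> Prop) (f : 'I_n -> T) :
  many n.+1 D -> exists x, D x /\ forall i, x <> f i.
Proof.
move=> [g [gi gD]]; apply: contrapT => /forallNP H.
have /choice[h hP] : forall i, exists j, g i = f j.
  move=> i; have /not_andP[/(_ (gD i))//|/existsNP[j /contrapT E]] := H (g i).
  by exists j.
have hi : injective h by move=> i j E; apply: gi; rewrite !hP E.
by have := max_card (mem (codom h)); rewrite card_codom // !card_ord ltnn.
Qed.

Lemma sval_inj T (P : T -> Prop) : injective (@sval T P).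
Proof. by move=> [x Px] [y Py] /= E; apply: eq_exist. Qed.

Lemma card_leE T U (A : set T) (B : set U) :
  A #<= B <-> exists f : {x | A x} -> {y | B y}, injective f.
Proof.
split=> [/card_leP[f]|[f fi]].
  exists (fun a => let b := f (SigSub (mem_set (svalP a))) in
    exist _ (val b) (set_mem (valP b))).
  move=> [x Ax] [y Ay] /= [/val_inj E]; apply: eq_exist.
  by have := inj _ _ E; rewrite !inE => /(_ I I)[].
apply/card_leP/injfunPex.
exists (fun a => let b := f (exist _ (val a) (set_mem (valP a))) in
  SigSub (mem_set (svalP b))) => // a b _ _ E.
have /fi E' : f (exist _ (val a) (set_mem (valP a))) =
    f (exist _ (val b) (set_mem (valP b))).
  by apply: sval_inj; exact: (congr1 val E).
by apply: val_inj; exact: (congr1 sval E').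
Qed.

Lemma infinite_many T (D : set T) : infinite_set D <-> forall N, many N D.
Proof.
split=> [/infiniteP/card_leE[f fi] N|].
  exists (fun i : 'I_N => sval (f (exist _ (val i) Logic.I))).
  split=> [i j E|i]; last exact: svalP.
  by apply: val_inj; exact: (congr1 sval (fi _ _ (sval_inj E))).
elim/Pchoice: T D => T D H /finite_seqP[s Ds].
have [x [Dx]] := many_avoid (tnth (in_tuple s)) (H (size s).+1).
have xs : x \in s by move: Dx; rewrite Ds.
by have /tnthP[i ->] : x \in in_tuple s by []; move=> /(_ i).
Qed.

(** * Equality of types and non-algebraicity *)

Section Model.
Variables (S : signature) (M : structure S) (s0 : sorts S).
Implicit Types (V W X Y Z : ctx S) (A B : pset M).

Definition eqtp B X (a a' : asg X M) := forall P : asg X M -> Prop, pdefinable B P -> P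
    a -> P a'.

Lemma eqtp_trans B X (a b c : asg X M) : eqtp B a b -> eqtp B b c -> eqtp B a c.
Proof. by move=> ab bc P dP Pa; apply: bc => //; apply: ab. Qed.

Lemma eqtp_sym B X (a a' : asg X M) : eqtp B a a' -> eqtp B a' a.
Proof. by move=> aa P dP Pa'; apply: contrapT => /(aa _ (pdefinable_not dP)). Qed.

Lemma eqtp_mono A B X (a a' : asg X M) : (forall s, A s `<=` B s) ->
  eqtp B a a' -> eqtp A a a'.
Proof. by move=> AB aa P dP; apply: aa; exact: pdefinable_mono dP. Qed.

Lemma eqtp_sub B X X' (r : ctx_map X X') (a a' : asg X' M) : eqtp B a a' ->
  eqtp B (fun s x => a s (r s x)) (fun s x => a' s (r s x)).
Proof. by move=> aa P dP; exact: (aa _ (pdefinable_sub r dP)). Qed.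

Lemma realizesE B X (a a' : asg X M) : realizes (tp B a) a' <-> eqtp B a a'.
Proof.
split=> [H P /pdefinable_formP[phi phiE] /phiE Pa|H phi pa].
  by apply/phiE; exact: H.
have := H (fun x => sat phi (vjoin x (@pval S M B))); apply=> //.
by apply/pdefinable_formP; exists phi.
Qed.

Lemma pdefinable_inst_adjoin A X Z (c : asg Z M) (P : asg X M -> asg Z M -> Prop) :
  pdefinable A (fun u : asg (csum X Z) M => P (lft u) (rgt u)) ->
  pdefinable (adjoin A c) (fun x => P x c).
Proof.
move=> dP; apply: (@pdefinable_inst _ _ _ _ _ P) => [s z|]; first by right; exists z.
by apply: pdefinable_mono dP => s m Am; left.
Qed.

Lemma eqtp_adjoinE A X Z (c : asg Z M) (a a' : asg X M) :
  eqtp (adjoin A c) a a' <-> eqtp A (vjoin a c) (vjoin a' c).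
Proof.
split=> H P dP.
  apply: (H (fun x => P (vjoin x c))).
  apply: (@pdefinable_inst_adjoin A X Z c (fun x z => P (vjoin x z))).
  by apply: pdefinable_ext dP => u; rewrite vjoinK.
have [Q [dQ PQ]] := pdefinable_adjoin dP; rewrite !PQ => Qa.
exact: (H (fun u => Q (lft u) (rgt u)) dQ).
Qed.

(** Stated with finite counts, so that a failure is witnessed by one formula; in a compact model it
    amounts to having infinitely many conjugates over [B]. *)
Definition nonalg B Y (e : asg Y M) :=
  forall P : asg Y M -> Prop, pdefinable B P -> P e -> forall N, many N P.

(** For [Q] over [A], the implication from [Q(e,c)] to [Q(.,c)] having at least [N] solutions is
    itself a condition on the pair definable over [A], so it passes to [(e', c')]. *)
Lemma nonalg_eqtp A Y Z (e e' : asg Y M) (c c' : asg Z M) : finite_ctx Y ->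
  eqtp A (vjoin e c) (vjoin e' c') -> nonalg (adjoin A c) e -> nonalg (adjoin A c') e'.
Proof.
move=> Yf ee ne P dP Pe' N.
have [Q [dQ PQ]] := pdefinable_adjoin dP.
apply: (@many_sub _ _ (fun y => Q y c')); first by move=> y /PQ.
pose R u := Q (lft u) (rgt u) -> many N (fun y => Q y (rgt u)).
have dR : pdefinable A (fun u : asg (csum Y Z) M => R u).
  apply: pdefinable_imp => //; apply: (pdefinable_many s0 _ (P := fun u y => Q y (rgt
      u))) => //.
  exact: (pdefinable_sub (fun s (v : csum Y Z s) => match v with inl y => inr y
     | inr z => inl (inr z) end) dQ).
suff : R (vjoin e c) by move/(ee R dR); apply; apply/PQ.
by move=> Qe; apply: (ne (fun y => Q y c)) => //; exact: pdefinable_inst_adjoin.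
Qed.

Lemma pdefinable_kinc B W X Y k (delta : form (csum X Y)) (D : asg W M -> asg Y M -> Prop) :
  finite_ctx X -> finite_ctx Y ->
  pdefinable B (fun u : asg (csum W Y) M => D (lft u) (rgt u)) ->
  pdefinable B (fun w => k_inconsistent k delta (D w)).
Proof.
move=> Xf Yf dD.
apply: (@pdefinable_ext _ _ _ _ (fun w => ~ exists f : 'I_k -> asg Y M,
  injective f /\ (forall i, D w (f i)) /\ exists x, forall i, sat delta (vjoin x (f i)))).
  move=> w; split=> [H f fi fD fx|H [f [fi [fD fx]]]]; last exact: (H f).
  by apply: H; exists f.
apply: pdefinable_not.
apply: (pdefinable_exfun (P := fun w f => injective f /\ (forall i, D w (f i)) /\
   exists x, forall i, sat delta (vjoin x (f i)))) => //.
apply: pdefinable_and; first exact: (pdefinable_proj_inj s0).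
apply: pdefinable_and.
  apply: (pdefinable_all s0) => [|i]; first exact: finite_type_ord.
  exact: (pdefinable_sub (fun s (v : csum W Y s) => match v with inl x => inl x
    | inr y => inr (existT (fun _ : 'I_k => Y s) i y) end) dD).
set U := csum W _.
apply: (pdefinable_ex (X := U) (Y := X) (P := fun u x => forall i : 'I_k, sat delta (vjoin x
   (fun s y => u s (inr (existT (fun _ : 'I_k => Y s) i y)))))) => //.
apply: (pdefinable_all s0) => [|i]; first exact: finite_type_ord.
have := pdefinable_sub (X' := csum U X) (fun s (v : csum X Y s) => match v with inl x
    => inr x
  | inr y => inl (inr (existT (fun _ : 'I_k => Y s) i y)) end) (pdefinable_sat (M := M)
      B delta).
apply: pdefinable_ext => u; rewrite (_ : (fun _ _ => _) = vjoin (rgt u)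
   (fun s y => lft u s (inr (existT (fun _ : 'I_k => Y s) i y)))) //.
by apply: functional_extensionality_dep => s; apply/funext => -[].
Qed.

Lemma k_inconsistent_sub k X Y (delta : form (csum X Y)) (D E : set (asg Y M)) :
  D `<=` E -> k_inconsistent k delta E -> k_inconsistent k delta D.
Proof. by move=> DE H f fi fD; apply: (H f fi) => i; exact: DE. Qed.

End Model.

(** * Compactness and algebraicity *)

(** The form in which saturation is used throughout: a directed family of relations in place of a
    finitely satisfiable set of formulas, so that each use only has to combine two conditions. *)
Definition compact_model S (M : structure S) (K : Type) :=
  forall (B : pset M) (X : ctx S) (G : (asg X M -> Prop) -> Prop),
  small K B -> finite_ctx X -> (forall P, G P -> pdefinable B P) -> (exists P, G P) ->
  (forall P Q, G P -> G Q -> exists R, G R /\ forall x, R x -> P x /\ Q x) ->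
  (forall P, G P -> exists x, P x) -> exists x, forall P, G P -> P x.

Section Compact.
Variables (S : signature) (M : structure S) (s0 : sorts S) (K : Type).
Implicit Types (V W X Y Z : ctx S) (A B : pset M).
Hypothesis cpt : compact_model M K.
Hypothesis small_adjoin : forall A Z (c : asg Z M),
  finite_ctx Z -> small K A -> small K (adjoin A c).

(** Each formula in the type of [b] over [Aa] gives an existential formula true of [a], hence of
    [a']; by compactness the whole type can be copied over [a']. *)
Lemma eqtp_move A X Y (a a' : asg X M) (b : asg Y M) : small K A ->
  finite_ctx X -> finite_ctx Y -> eqtp A a a' ->
  exists b', eqtp A (vjoin a b) (vjoin a' b').
Proof.
move=> As Xf Yf aa.
pose G (P : asg Y M -> Prop) := exists Q : asg X M -> asg Y M -> Prop,
  [/\ pdefinable A (fun u : asg (csum X Y) M => Q (lft u) (rgt u)), Q a b &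
      P = Q a'].
have [||||b' b'P] := cpt (B := adjoin A a') (G := G) (small_adjoin Xf As) Yf.
- move=> _ [Q [dQ Qb ->]].
  apply: (@pdefinable_inst_adjoin _ M A Y X a' (fun y x => Q x y)).
  exact: (pdefinable_sub (fun s (v : csum X Y s) => match v with inl y => inr y
     | inr z => inl z end) dQ).
- by exists (fun _ => True), (fun _ _ => True); split=> //; exact: (pdefinable_cst s0).
- move=> _ _ [Q [dQ Qb ->]] [R [dR Rb ->]].
  exists (fun y => Q a' y /\ R a' y); split=> //.
  by exists (fun x y => Q x y /\ R x y); split=> //; exact: pdefinable_and.
- move=> _ [Q [dQ Qb ->]].
  by apply: (aa (fun x => exists y, Q x y)); [exact: pdefinable_ex|exists b].
exists b' => P dP Pab.
apply: (b'P (fun y => P (vjoin a' y))); exists (fun x y => P (vjoin x y)); split=> //.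
by apply: pdefinable_ext dP => u; rewrite vjoinK.
Qed.

(** If there were finitely many realizations, compactness would give one more, different from all of
    them, since each formula of the type has solutions outside any finite list. *)
Lemma nonalg_infinite B Y (e : asg Y M) : small K B -> finite_ctx Y ->
  nonalg B e <-> infinite_set [set e' | realizes (tp B e) e'].
Proof.
move=> Bs Yf; split=> [ne|/infinite_many H P dP Pe N]; last first.
  by apply: many_sub (H N) => e' /realizesE; apply.
apply/infinite_many => N; apply: contrapT => nN.
(* With [n] the largest number of distinct realizations, [f] lists them all. *)
have [n [f [fi fP] nn]] : exists n, exists2 f : 'I_n -> asg Y M,
    injective f /\ (forall i, eqtp B e (f i)) &
    ~ many n.+1 (fun e' => eqtp B e e').
  elim: N nN => [|N IH] nN.
    case: nN; exists (fun i : 'I_0 => e); by split=> [[]|[]].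
  have [mN|mN] := pselect (many N (fun e' => eqtp B e e')).
    exists N; case: mN => f fP; exists f => // H; apply: nN.
    by apply: many_sub H => e' /realizesE.
  by apply: IH => H; apply: mN; apply: many_sub H => e' /realizesE.
have cf : finite_ctx (cbig (fun _ : 'I_n => Y)).
  by apply: finite_cbig => //; exact: finite_type_ord.
pose c : asg (cbig (fun _ : 'I_n => Y)) M := fun s z => f (projT1 z) s (projT2 z).
have fc i : forall s y, adjoin B c s (f i s y).
  by move=> s y; right; exists (existT _ i y).
pose G (P : asg Y M -> Prop) := exists Q : asg Y M -> Prop,
  [/\ pdefinable B Q, Q e & P = fun y => Q y /\ forall i, y <> f i].
have [||||e' e'P] := cpt (B := adjoin B c) (G := G) (small_adjoin cf Bs) Yf.
- move=> _ [Q [dQ Qb ->]]; apply: pdefinable_and.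
    by apply: pdefinable_mono dQ => s m; left.
  apply: (pdefinable_all s0) => [|i]; first exact: finite_type_ord.
  apply: pdefinable_not; exact: (pdefinable_eq_tuple s0).
- exists (fun y => True /\ forall i, y <> f i), (fun _ => True); split=> //.
  exact: (pdefinable_cst s0).
- move=> _ _ [Q [dQ Qe ->]] [R [dR Re ->]].
  exists (fun y => (Q y /\ R y) /\ forall i, y <> f i); split; last by move=> y; tauto.
  by exists (fun y => Q y /\ R y); split=> //; exact: pdefinable_and.
- move=> _ [Q [dQ Qe ->]].
  exact: (many_avoid f (ne _ dQ Qe n.+1)).
apply: nn; exists (fun i => oapp f e' (unlift ord0 i)); split.
  have ne' i : f i <> e'.
    have [|_ /(_ i) H] := e'P (fun y => True /\ forall i, y <> f i).
      by exists (fun _ => True); split=> //; exact: (pdefinable_cst s0).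
    exact/nesym.
  move=> i j; case: unliftP => [i'|] ->; case: unliftP => [j'|] -> //=.
  - by move/fi ->.
  - by move/ne'.
  - by move/esym/ne'.
move=> i; case: (unlift _ i) => [j|] //= P dP Pe.
have [|//] := e'P (fun y => P y /\ forall i, y <> f i).
by exists P.
Qed.

(** By compactness a single formula of the type already witnesses [k]-inconsistency: otherwise each
    of its formulas has [k] distinct solutions whose instances share an [x], and then so does the
    type itself. *)
Lemma strongly_dividesE B X Y (delta : form (csum X Y)) (e : asg Y M) :
  small K B -> finite_ctx X -> finite_ctx Y ->
  strongly_divides B delta e <-> nonalg B e /\
    exists k P, [/\ pdefinable B P, P e & k_inconsistent k delta P].
Proof.
move=> Bs Xf Yf; split=> [[/(nonalg_infinite e Bs Yf) ne [k kinc]]|]; last first.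
  move=> [ne [k [P [dP Pe kinc]]]]; split; first exact/nonalg_infinite.
  by exists k; apply: k_inconsistent_sub kinc => e' /realizesE; apply.
split=> //; exists k; apply: contrapT => H.
have {}H P : pdefinable B P -> P e -> ~ k_inconsistent k delta P.
  by move=> dP Pe kP; apply: H; exists P.
pose Yk := cbig (fun _ : 'I_k => Y).
pose com (u : asg Yk M) (i : 'I_k) : asg Y M := fun s y => u s (existT (fun _ : 'I_k =>
    Y s) i y).
have Ykf : finite_ctx Yk by apply: finite_cbig => //; exact: finite_type_ord.
pose F P (u : asg Yk M) := injective (com u) /\ (forall i, P (com u i)) /\
   exists x : asg X M, forall i, sat delta (vjoin x (com u i)).
pose G (R : asg Yk M -> Prop) := exists P, [/\ pdefinable B P, P e & R = F P].
have [||||u uP] := cpt (B := B) (G := G) Bs Ykf.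
- move=> _ [P [dP Pe ->]]; apply: pdefinable_and.
    have := pdefinable_sub (X := csum cnil Yk) (X' := Yk) (fun s v => match v with
      inl e => match e with end | inr y => y end) (pdefinable_proj_inj s0 k B cnil Yf).
    by apply: pdefinable_ext => u.
  apply: pdefinable_and.
    apply: (pdefinable_all s0) => [|i]; first exact: finite_type_ord.
    exact: (pdefinable_sub (fun s y => existT (fun _ : 'I_k => Y s) i y) dP).
  apply: (pdefinable_ex (P := fun u x => forall i : 'I_k, sat delta (vjoin x (com u
      i)))) => //.
  apply: (pdefinable_all s0) => [|i]; first exact: finite_type_ord.
  have := pdefinable_sub (X' := csum Yk X) (fun s (v : csum X Y s) => match v with inl
      x => inr x
    | inr y => inl (existT (fun _ : 'I_k => Y s) i y) end) (pdefinable_sat (M := M) B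
        delta).
  apply: pdefinable_ext => v; rewrite (_ : (fun _ _ => _) = vjoin (rgt v) (com (lft v)
      i)) //.
  by apply: functional_extensionality_dep => s; apply/funext => -[].
- by exists (F (fun _ => True)), (fun _ => True); split=> //; exact: (pdefinable_cst s0).
- move=> _ _ [P [dP Pe ->]] [Q [dQ Qe ->]].
  exists (F (fun y => P y /\ Q y)); split.
    by exists (fun y => P y /\ Q y); split=> //; exact: pdefinable_and.
  by move=> u [? [h ?]]; split; split=> //; split=> // i; have [] := h i.
- move=> _ [P [dP Pe ->]]; apply: contrapT => nP; apply: (H P dP Pe).
  move=> f fi fP [x xP]; apply: nP; exists (fun s z => f (projT1 z) s (projT2 z)).
  by split=> //; split=> //; exists x.
have [|ui [_ ux]] := uP (F (fun _ => True)).
  by exists (fun _ => True); split=> //; exact: (pdefinable_cst s0).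
apply: (kinc (com u)) => // i; apply/realizesE => P dP Pe.
by have [|_ [/(_ i) h _]] := uP (F P); first by exists P.
Qed.

End Compact.

(** * Definable approximations of thorn-rank *)

Section Trees.
Variables (S : signature) (M : structure S) (s0 : sorts S).
Variables (r : nat) (X : ctx S) (Y Z : 'I_r -> ctx S).
Variables (delta : forall j, form (csum X (Y j))).
Variables (Pi : forall j, asg (Y j) M -> asg (Z j) M -> Prop) (k : 'I_r -> nat).
Implicit Types (A B : pset M) (P : asg X M -> Prop).

(* A finite approximation of [th(P,...) >= n]: "infinitely many" is weakened to
   [N.+1], which makes the condition definable. *)
Fixpoint tree (J : 'I_r -> Prop) (n N : nat) P : Prop :=
  if n is n'.+1 then exists j, J j /\ exists c : asg (Z j) M,
    k_inconsistent (k j) (delta j) (fun a => Pi a c) /\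
    many N.+1 (fun a => Pi a c /\ tree J n' N (fun x => P x /\ sat (delta j) (vjoin x a)))
  else exists x, P x.

Lemma tree_sub J n N P Q : (forall x, P x -> Q x) -> tree J n N P -> tree J n N Q.
Proof.
elim: n P Q => /= [|n IH] P Q PQ; first by case=> x /PQ; exists x.
move=> [j [Jj [c [kc h]]]]; exists j; split=> //; exists c; split=> //.
by apply: many_sub h => a [? h]; split=> //; apply: IH h => x [/PQ].
Qed.

Lemma tree_cons J n N P : tree J n N P -> exists x, P x.
Proof.
elim: n P => //= n IH P [j [_ [c [_ h]]]].
have /many1[a [_ /IH[x [Px _]]]] := many_le (isT : 0 < N.+1) h.
by exists x.
Qed.

Lemma tree_leN J n N N' P : N <= N' -> tree J n N' P -> tree J n N P.
Proof.
move=> NN; elim: n P => //= n IH P [j [Jj [c [kc h]]]].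
exists j; split=> //; exists c; split=> //.
by apply: many_le (_ : N < N'.+1) _ => //; apply: many_sub h => a [? /IH].
Qed.

Lemma tree_len J n n' N P : n <= n' -> tree J n' N P -> tree J n N P.
Proof.
elim: n' n P => [|n' IH] [|n] P //; first by move=> _ /tree_cons.
rewrite ltnS => nn /= [j [Jj [c [kc h]]]]; exists j; split=> //; exists c; split=> //.
by apply: many_sub h => a [? /(IH _ _ nn)].
Qed.

(** Finitary counterpart of an undefined rank. The trees for different [n] and [N] are unrelated;
    compactness in [rich_step] makes them share their first step. *)
Definition rich J P := forall n N, tree J n N P.

(** Induction on the total height. If the root uses index [i], each child contains a tree of one
    colour, with one level less demanded of colour [i]. A child of another colour already suffices;
    otherwise all children have colour [i], and the root adds the missing level. *)
Lemma tree_color (t : 'I_r -> nat) N P (j0 : 'I_r) :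
  tree (fun _ => True) (\sum_j t j) N P -> exists j, tree (fun i => i = j) (t j) N P.
Proof.
move: {2}(\sum_j t j) (erefl (\sum_j t j)) => d.
elim: d t P => [|d IH] t P E h.
  have tj : t j0 = 0 by move/eqP: E; rewrite sum_nat_eq0 => /forallP/(_ j0)/eqP.
  by exists j0; rewrite tj; exact: tree_cons h.
move: (h); rewrite E => -[i [_ [c [kc hc]]]].
case ti : (t i) => [|ti'].
  by exists i; rewrite ti; exact: tree_cons h.
pose t' j := if j == i then ti' else t j.
have t'd : \sum_j t' j = d.
  apply: succn_inj; rewrite -E (bigD1 i) //= [RHS](bigD1 i) //= /t' eqxx ti addSn.
  by congr (_ + _).+1; apply: eq_bigr => j /negPf ->.
have H a : Pi a c /\ tree (fun _ => True) d N (fun x => P x /\ sat (delta i) (vjoin x a)) ->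
    exists j, tree (fun i => i = j) (t' j) N (fun x => P x /\ sat (delta i) (vjoin x a)).
  by move=> [_]; rewrite -t'd => ha; apply: IH.
have [[a [Ha [j ji hj]]]|nH] := pselect (exists a,
  (Pi a c /\ tree (fun _ => True) d N (fun x => P x /\ sat (delta i) (vjoin x a))) /\
  exists2 j, j <> i & tree (fun i => i = j) (t' j) N (fun x => P x /\ sat (delta i)
      (vjoin x a))).
  exists j; move: hj; rewrite /t'; case: eqP => // _.
  by apply: tree_sub => x [].
exists i; rewrite ti /=; exists i; split=> //; exists c; split=> //.
apply: many_sub hc => a Ha; split; first by case: Ha.
have [j] := H a Ha; have [->|ji hj] := pselect (j = i); first by rewrite /t' eqxx.
by case: nH; exists a; split=> //; exists j.
Qed.

(** If each index [j] failed at some [n j], [N j], a tree whose height is the sum of the [n j] and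
    whose branching bounds all the [N j] would contradict [tree_color]. *)
Lemma rich_color P : rich (fun _ => True) P -> exists j, rich (fun i => i = j) P.
Proof.
move=> h; have [j0 _] := h 1 0.
apply: contrapT => /forallNP nH.
have /dep_choice[n /dep_choice[N nN]] : forall j, exists n N, ~ tree (fun i => i = j) n N P.
  by move=> j; have /existsNP[n /existsNP[N ?]] := nH j; exists n, N.
have [j hj] := tree_color (t := n) (N := \sum_j N j) j0 (h _ _).
apply: (nN j); apply: tree_leN hj.
by rewrite (bigD1 j) //= leq_addr.
Qed.

Hypotheses (Xf : finite_ctx X) (Yf : forall j, finite_ctx (Y j))
  (Zf : forall j, finite_ctx (Z j)).
Variable A : pset M.
Hypothesis dPi : forall j, pdefinable A (fun u : asg (csum (Y j) (Z j)) M => Pi (lft u)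
    (rgt u)).

Lemma pdefinable_Pi B U j (f : ctx_map (Y j) U) (g : ctx_map (Z j) U) :
  (forall s, @A s `<=` B s) ->
  pdefinable B (fun u : asg U M => Pi (fun s y => u s (f s y)) (fun s z => u s (g s z))).
Proof.
move=> AB; exact: (pdefinable_sub (fun s v => match v with inl y => f s y | inr z => g
    s z end)
  (pdefinable_mono AB (dPi j))).
Qed.

Lemma pdefinable_kincPi B U j (g : ctx_map (Z j) U) : (forall s, @A s `<=` B s) ->
  pdefinable B (fun u : asg U M =>
    k_inconsistent (k j) (delta j) (fun a => Pi a (fun s z => u s (g s z)))).
Proof.
move=> AB; apply: (pdefinable_kinc s0 (k j) (delta j) (D := fun u a => Pi a (fun s z =>
    u s (g s z)))) => //.
exact: (pdefinable_Pi (U := csum U (Y j)) (fun s => inr) (fun s z => inl (g s z))).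
Qed.

Lemma pdefinable_delta B U j (f : ctx_map X U) (g : ctx_map (Y j) U) :
  pdefinable B (fun u : asg U M =>
    sat (delta j) (vjoin (fun s x => u s (f s x)) (fun s y => u s (g s y)))).
Proof.
have := pdefinable_sub (M := M) (fun s v => match v with inl y => f s y | inr z => g s
    z end)
  (pdefinable_sat (M := M) B (delta j)).
apply: pdefinable_ext => u; rewrite (_ : (fun _ _ => _) =
  vjoin (fun s x => u s (f s x)) (fun s y => u s (g s y))) //.
by apply: functional_extensionality_dep => s; apply/funext => -[].
Qed.

(** [P] depends on [w] because descending to a child turns its tuple [a] into a new variable of the
    condition. *)
Lemma pdefinable_tree B J n N W (P : asg W M -> asg X M -> Prop) :
  (forall s, @A s `<=` B s) ->
  pdefinable B (fun u : asg (csum W X) M => P (lft u) (rgt u)) ->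
  pdefinable B (fun w => tree J n N (P w)).
Proof.
move=> AB; elim: n W P => [|n IH] W P dP /=; first exact: pdefinable_ex.
apply: (pdefinable_exi s0) => [|j]; first exact: finite_type_ord.
apply: pdefinable_and; first exact: (pdefinable_cst s0).
apply: (pdefinable_ex (P := fun w c => k_inconsistent (k j) (delta j) (fun a => Pi a c) /\
    many N.+1 (fun a => Pi a c /\ tree J n N (fun x => P w x /\ sat (delta j) (vjoin x
        a))))) => //.
apply: pdefinable_and; first exact: (pdefinable_kincPi (fun s => inr)).
apply: (pdefinable_many s0 _ (P := fun u a => Pi a (rgt u) /\
   tree J n N (fun x => P (lft u) x /\ sat (delta j) (vjoin x a)))) => //.
apply: pdefinable_and; first exact: (pdefinable_Pi (U := csum (csum W (Z j)) (Y j))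
    (fun s => inr) (fun s z => inl (inr z))).
apply: (IH _ (fun u x => P (lft (lft u)) x /\ sat (delta j) (vjoin x (rgt u)))).
apply: pdefinable_and.
  exact: (pdefinable_sub (X' := csum (csum (csum W (Z j)) (Y j)) X) (fun s v => match v with
    inl w => inl (inl (inl w)) | inr x => inr x end) dP).
exact: (pdefinable_delta _ (U := csum (csum (csum W (Z j)) (Y j)) X) (fun s => inr)
    (fun s y => inl (inr y))).
Qed.

Variable K : Type.
Hypothesis cpt : compact_model M K.

(** Compactness is applied to the pair of [c] and [a]. A finite part asks for a tree below [a] and
    excludes finitely many formulas with boundedly many solutions; a taller tree with enough
    children provides it. *)
Lemma rich_step B j P : small K B -> (forall s, @A s `<=` B s) -> pdefinable B P ->
  rich (fun i => i = j) P ->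
  exists (c : asg (Z j) M) (a : asg (Y j) M),
  [/\ k_inconsistent (k j) (delta j) (fun a => Pi a c), Pi a c, nonalg (adjoin B c) a &
      rich (fun i => i = j) (fun x => P x /\ sat (delta j) (vjoin x a))].
Proof.
move=> Bs AB dP hP.
pose R := fun i => i = j.
pose F n N (Q : asg (Y j) M -> asg (Z j) M -> Prop) (u : asg (csum (Z j) (Y j)) M) :=
  (k_inconsistent (k j) (delta j) (fun a => Pi a (lft u)) /\ Pi (rgt u) (lft u)) /\
  (tree R n N (fun x => P x /\ sat (delta j) (vjoin x (rgt u))) /\ ~ Q (rgt u) (lft u)).
(* The bound on [Q(.,c)] holds for every [c], so that [Q] can be excluded before [c] is known. *)
pose good m (Q : asg (Y j) M -> asg (Z j) M -> Prop) :=
  pdefinable B (fun u : asg (csum (Y j) (Z j)) M => Q (lft u) (rgt u)) /\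
  forall c, ~ many m (fun a => Q a c).
pose G T := exists n N m Q, good m Q /\ T = F n N Q.
have good0 : good 1 (fun _ _ => False).
  by split=> [|c /many1[]//]; exact: (pdefinable_cst s0).
have [|||||u uP] := cpt (B := B) (G := G) Bs (X := csum (Z j) (Y j)).
- exact: finite_csum.
- move=> _ [n [N [m [Q [[dQ _] ->]]]]].
  apply: pdefinable_and; first apply: pdefinable_and.
  + exact: (pdefinable_kincPi (fun s => inl)).
  + exact: (pdefinable_Pi (U := csum (Z j) (Y j)) (fun s => inr) (fun s => inl)).
  apply: pdefinable_and.
    apply: (@pdefinable_tree B R n N (csum (Z j) (Y j)) (fun u x => P x /\ sat (delta
        j) (vjoin x (rgt u)))) => //.
    apply: pdefinable_and; first exact: (pdefinable_sub (X' := csum (csum (Z j) (Y j))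
        X) (fun s => inr) dP).
    exact: (pdefinable_delta _ (U := csum (csum (Z j) (Y j)) X) (fun s => inr) (fun s y
        => inl (inr y))).
  apply: pdefinable_not; exact: (pdefinable_sub (X' := csum (Z j) (Y j)) (fun s (v :
      csum (Y j) (Z j) s) => match v with
    inl w => inr w | inr x => inl x end) dQ).
- by exists (F 0 0 (fun _ _ => False)), 0, 0, 1, (fun _ _ => False).
- move=> _ _ [n [N [m [Q [[dQ mQ] ->]]]]] [n' [N' [m' [Q' [[dQ' mQ'] ->]]]]].
  exists (F (maxn n n') (maxn N N') (fun a c => Q a c \/ Q' a c)); split.
    exists (maxn n n'), (maxn N N'), (m + m'), (fun a c => Q a c \/ Q' a c).
    split=> //; split; first exact: pdefinable_or.
    move=> c /(many_split (fun _ h => h))[h|h].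
      apply: (mQ c); apply: (@many_le _ _ m.+1); first exact: leqnSn.
      by apply: many_sub h => a [].
    by apply: (mQ' c); apply: many_sub h => a [].
  move=> u [kP [h nQ]]; split; split=> //; split; try by move=> H; apply: nQ; tauto.
    by apply: tree_leN (leq_maxl N N') _; apply: tree_len (leq_maxl n n') h.
  by apply: tree_leN (leq_maxr N N') _; apply: tree_len (leq_maxr n n') h.
- move=> _ [n [N [m [Q [[dQ mQ] ->]]]]].
  (* Fewer than [m] children satisfy [Q], so the surplus [m] leaves one that does not; the extra
     level is the one at which [a] is chosen. *)
  have [_ [-> [c [kc h]]]] := hP n.+1 (N + m).
  have H : many (N.+1 + m) (fun a => Pi a c /\
      tree R n (N + m) (fun x => P x /\ sat (delta j) (vjoin x a))).
    by rewrite addSn.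
  have notQ a : ~ Q a c \/ Q a c by have [?|?] := EM (Q a c); [right|left].
  have [{}h|{}h] := many_split (P := fun a => ~ Q a c) (Q := fun a => Q a c)
    (fun a _ => notQ a) H; last first.
    by case: (mQ c); apply: many_sub h => a [].
  have /many1[a [[Pa ha] nQa]] := many_le (isT : 0 < N.+2) h.
  exists (vjoin c a); split; split=> //.
  by apply: tree_leN (leq_addr _ _) ha.
have uQ n N m Q : good m Q -> F n N Q u.
  by move=> gQ; apply: uP; exists n, N, m, Q.
have [[kc Pc] _] := uQ 0 0 1 _ good0.
exists (lft u), (rgt u); split=> //; last first.
  by move=> n N; have [_ []] := uQ n N 1 _ good0.
move=> T /pdefinable_adjoin[Q [dQ TQ]] /TQ Qu m; apply: contrapT => nm.
(* Restricting [Q] to those [c] for which it has fewer than [m] solutions makes the bound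
   uniform. *)
pose Q' a c := Q a c /\ ~ many m (fun a => Q a c).
have [|_ [_]] := uQ 0 0 m Q'.
  split=> [|c H].
    apply: pdefinable_and => //; apply: pdefinable_not.
    apply: (pdefinable_many s0 _ (X := csum (Y j) (Z j)) (P := fun u a => Q a (rgt u)))
        => //.
    exact: (pdefinable_sub (X' := csum (csum (Y j) (Z j)) (Y j)) (fun s (v : csum (Y j)
        (Z j) s) => match v with
     inl w => inr w | inr x => inl (inr x) end) dQ).
  have nm0 : ~ many m (fun a => Q a c).
    have m0 : 0 < m.
      rewrite lt0n; apply/eqP => m0; apply: nm; rewrite m0.
      by exists (fun _ => rgt u); split=> -[].
    have /many1[a [_]] := many_le m0 H; exact.
  by apply: nm0; apply: many_sub H => a [].
apply; split=> // h; apply: nm; apply: many_sub h => a; by move/TQ.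
Qed.

End Trees.

Lemma sat_inst S (M : structure S) (X Y : ctx S) (delta : form (csum X Y)) (a : asg Y M)
    (x : asg X M) :
  sat (inst delta a) (vjoin x (@selfval S M)) <-> sat delta (vjoin x a).
Proof.
by apply: sat_rename_eq => s [].
Qed.

Lemma pdefinable_formM S (M : structure S) (A : pset M) X (phi : form (csum X (carrier
    M))) :
  exists W (w : asg W M), finite_ctx W /\
    pdefinable (adjoin A w) (fun x : asg X M => sat phi (vjoin x (@selfval S M))).
Proof.
pose T : pset M := fun s => setT.
have [] := @pdefinable_support S M T X (fun x => sat phi (vjoin x (@selfval S M))).
  exists (fun u => sat phi (fun s v => u s (match v with inl x => inl x
    | inr m => inr (exist _ m Logic.I) end))); split.
    by apply: definable_sub; exists phi.
  move=> x; rewrite (_ : vjoin _ _ = (fun s v => vjoin x (@pval S M T) s (match v with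
      inl x => inl x
    | inr m => inr (exist _ m Logic.I) end))) //.
  by apply: functional_extensionality_dep => s; apply/funext => -[].
move=> W [w [Q [Wf _ dQ PQ]]]; exists W, w; split=> //.
apply: (@pdefinable_ext _ _ _ _ (fun x => Q x w)) => [x|]; first by rewrite PQ.
by apply: pdefinable_inst_adjoin; exact: definable_defO.
Qed.

(** * Trees of all depths refute rosiness *)

Section RosyRich.
Variables (S : signature) (M : structure S) (s0 : sorts S).
Variables (r : nat) (X : ctx S) (Y Z : 'I_r -> ctx S).
Variables (delta : forall j, form (csum X (Y j))).
Variables (Pi : forall j, asg (Y j) M -> asg (Z j) M -> Prop) (k : 'I_r -> nat).
Hypotheses (Xf : finite_ctx X) (Yf : forall j, finite_ctx (Y j))
  (Zf : forall j, finite_ctx (Z j)).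
Variable A : pset M.
Hypothesis dPi : forall j, pdefinable A (fun u : asg (csum (Y j) (Z j)) M => Pi (lft u)
    (rgt u)).
Variable K : Type.
Hypothesis cpt : compact_model M K.
Hypothesis small_adjoin : forall (A : pset M) (Z : ctx S) (c : asg Z M),
  finite_ctx Z -> small K A -> small K (adjoin A c).

(** Once one index is isolated, a least ordinal at which the rank bound fails is refuted: at a
    successor, [rich_step] supplies [a], and its conjugates form the infinite set of the rank
    clause. *)
Lemma rosy_not_rich : rosy M -> small K A ->
  ~ rich delta Pi k (fun _ => True) (fun _ => True).
Proof.
move=> rM As /rich_color[j].
have /pdefinable_formP[pi0 pi0E] := dPi j.
(* The parameters from [A] join [c] in the variable [z] of the rank, which may therefore be
   infinite. *)
pose pi : form (csum (Y j) (csum (Z j) (params A))) := rename (fun s v => match v with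
  inl (inl y) => inl y | inl (inr z) => inr (inl z) | inr p => inr (inr p) end) pi0.
have piE a c : sat pi (vjoin a (vjoin c (@pval S M A))) <-> Pi a c.
  apply: iff_trans (iff_sym (pi0E (vjoin a c))); by apply: sat_rename_eq => s [[]|].
pose P (phi : form (csum X (carrier M))) (x : asg X M) := sat phi (vjoin x (@selfval S M)).
suff main W (R : rel W) w phi : well_order R ->
    rich delta Pi k (fun i => i = j) (P phi) ->
    th_ge R phi [set delta j] [set pi] (k j) w.
  pose psi : form (csum X (carrier M)) :=
    FEx (FEq (Var (V := cext (csum X (carrier M)) s0) (inr erefl)) (Var (inr erefl))).
  pose top := FNeg (FAnd psi (FNeg psi)).
  have topP x : P top x by rewrite /P /=; tauto.
  move=> richT.
  have [W [R [w [wR]]]] := rM X (Y j) _ top [set delta j] [set pi] (k j) Xf (Yf j)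
    (@finite_set1 _ _) (@finite_set1 _ _).
  apply; apply: main => // n N; apply: tree_sub (richT n N) => x _; exact: topP.
move=> wR; apply: contraPP => nth rphi.
pose bad := [pred v | `[< exists phi, rich delta Pi k (fun i => i = j) (P phi) /\
  ~ th_ge R phi [set delta j] [set pi] (k j) v >]].
have /wR[v [[]]] : nonempty bad by exists w; rewrite inE; exists phi.
rewrite inE => -[{nth rphi}phi [rphi nth]] minv _; apply: nth.
have {minv}IH u chi : olt R u v -> rich delta Pi k (fun i => i = j) (P chi) ->
    th_ge R chi [set delta j] [set pi] (k j) u.
  move=> /negP uv rchi; apply: contrapT => nth; apply: uv; apply: minv.
  by rewrite inE; exists chi.
have [vz|vnz] := pselect (ozero R v).
  by apply: th_ge_zero => //; exact: (rphi 0 0).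
have [[u uv]|nsucc] := pselect (exists u, osucc R u v); last first.
  apply: th_ge_limit => [|u uv]; last exact: IH.
  by split=> // u uv; apply: nsucc; exists u.
have [W' [b [W'f dphi]]] := pdefinable_formM A phi.
pose B := adjoin A b.
have Bs : small K B by exact: small_adjoin.
have AB s : @A s `<=` B s by left.
have [c [a [kc Pc ne ra]]] := rich_step s0 Xf Yf Zf dPi cpt Bs AB dphi rphi.
(* Conjugates of [a] over [Bc] also satisfy [Pi] and carry the same trees, as each tree condition is
   definable over [Bc]. *)
pose D := [set a' | realizes (tp (adjoin B c) a) a'].
have BBc s : B s `<=` adjoin B c s by left.
have ABc s : @A s `<=` adjoin B c s by move=> m /AB/BBc.
apply: (@th_ge_succ _ _ _ R X (Y j) _ phi _ _ (k j) u v (delta j) pi (vjoin c (@pval S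
    M A)) D) => //.
- by apply/(nonalg_infinite s0 cpt small_adjoin) => //; exact: small_adjoin.
- move=> a' /realizesE Da' /=; apply/piE; apply: (Da' (fun a => Pi a c)) => //.
  by apply: pdefinable_inst_adjoin; exact: pdefinable_mono (dPi j).
- move=> a' /realizesE Da'; apply: IH; first by case: uv.
  move=> n N; have := ra n N; move/(Da' (fun a => tree delta Pi k (eq^~ j) n N (fun x
      => _ /\ sat (delta j) (vjoin x a)))).
  move=> H; apply: (@tree_sub _ _ _ _ _ _ _ _ _ _ _ _ (fun x => P phi x /\ sat (delta
      j) (vjoin x a'))).
    by move=> x [Px dx]; split=> //=; apply/sat_inst.
  apply: H; apply: (pdefinable_tree s0 delta k Xf Yf Zf dPi _ n N (P := fun a x => P
      phi x /\ sat (delta j) (vjoin x a))) => //.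
  apply: pdefinable_and; last exact: (pdefinable_delta _ _ (U := csum (Y j) X) (fun s
      => inr) (fun s => inl)).
  exact: (pdefinable_sub (X' := csum (Y j) X) (fun s => inr) (pdefinable_mono BBc dphi)).
- move=> f fi fD; apply: (kc f fi) => i; apply/piE; exact: fD.
Qed.

End RosyRich.

(** * Undefined thorn-ranks *)

Section WellOrder.
Variables (W : Type) (R : rel W).
Hypothesis wR : well_order R.

Lemma wo_min (P : W -> Prop) : (exists w, P w) -> exists2 w, P w & forall v, P v -> R w v.
Proof.
move=> [w Pw]; have [|z [[]]] := wR (A := [pred v | `[< P v >]]).
  by exists w; rewrite inE.
by rewrite inE => Pz lz _; exists z => // v Pv; apply: lz; rewrite inE.
Qed.

Lemma wo_total v w : R v w \/ R w v.
Proof.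
have [|z [->|->] H] := @wo_min (fun u => u = v \/ u = w); first by exists v; left.
  by left; apply: H; right.
by right; apply: H; left.
Qed.

(** Antisymmetry comes from the uniqueness of minima in [well_order], applied to the pair of [v] and
    [w]. *)
Lemma wo_anti v w : R v w -> R w v -> v = w.
Proof.
move=> vw wv.
have vv : R v v by have [] := wo_total v v.
have ww : R w w by have [] := wo_total w w.
have [|z [_ uz]] := wR (A := [pred u | `[< u = v \/ u = w >]]).
  by exists v; rewrite inE; left.
transitivity z; [symmetry|]; apply: uz; split; rewrite ?inE; try by [left|right].
  by move=> u; rewrite inE => -[->|->].
by move=> u; rewrite inE => -[->|->].
Qed.

End WellOrder.

Lemma ex_well_order T : exists R : rel T, well_order R.
Proof. by elim/Peq: T => T; have [R] := well_ordering_principle T; exists R. Qed.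

Section Rank.
Variables (S : signature) (M : structure S) (X Y Z : ctx S).
Implicit Types (Delta : set (form (csum X Y))) (Pi : set (form (csum Y Z))) (k : nat).

Lemma th_ge_cons W (R : rel W) (phi : form (csum X (carrier M))) Delta Pi k w :
  th_ge R phi Delta Pi k w -> exists x : asg X M, sat phi (vjoin x (@selfval S M)).
Proof.
elim=> {Delta Pi k phi w} [|phi Delta Pi k w [nz _] _ IH
    |phi Delta Pi k v w delta pi c D _ _ _ infD _ _ IH _] //.
  by have /existsNP[v /negP] := nz; exact: IH.
by have [a Da] := infinite_setN0 infD; have [x []] := IH a Da; exists x.
Qed.

Lemma th_ge_sub W (R : rel W) (phi psi : form (csum X (carrier M))) Delta Pi k w :
  (forall x : asg X M, sat phi (vjoin x (@selfval S M)) -> sat psi (vjoin x (@selfval S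
      M))) ->
  th_ge R phi Delta Pi k w -> th_ge R psi Delta Pi k w.
Proof.
move=> H h; elim: h psi H => {Delta Pi k phi w} [phi Delta Pi k w wz [x px]|phi Delta
    Pi k w lw _ IH
    |phi Delta Pi k v w delta pi c D sv De Pe infD DP _ IH kc] psi H.
- by apply: th_ge_zero => //; exists x; exact: H.
- by apply: th_ge_limit => // v vw; exact: IH.
apply: (th_ge_succ sv De Pe infD DP) => // a Da.
apply: (IH a Da) => x /= [px dx]; split=> //; exact: H.
Qed.

(** At a successor, any child has the smaller rank by induction, and its formula implies that of the
    parent. *)
Lemma th_ge_mono W (R : rel W) (phi : form (csum X (carrier M))) Delta Pi k v w :
    well_order R ->
  R v w -> th_ge R phi Delta Pi k w -> th_ge R phi Delta Pi k v.
Proof.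
move=> wR vw h; elim: h v vw => {Delta Pi k phi w} [phi Delta Pi k w wz px|phi Delta Pi
    k w lw h IH
    |phi Delta Pi k v w delta pi c D sv De Pe infD DP h IH kc] u uw.
- by rewrite (wo_anti wR uw (wz u)); exact: th_ge_zero.
- have [wu|/negP wu] := pselect (R w u); last exact: h.
  by rewrite (wo_anti wR uw wu); exact: th_ge_limit.
have [wu|/negP wu] := pselect (R w u).
  by rewrite (wo_anti wR uw wu); exact: (th_ge_succ sv De Pe infD DP).
have [a Da] := infinite_setN0 infD.
have := IH a Da u (sv.2 u wu); apply: th_ge_sub => x.
by case.
Qed.

Lemma cantor_not_injective T (f : (set T -> Prop) -> set T) : ~ injective f.
Proof.
move=> fi; pose P (A : set T) := exists2 Q, f Q = A & ~ Q A.
have nP : ~ P (f P) by move=> h; have [Q /fi QP] := h; rewrite QP.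
by apply: (nP); exists P.
Qed.

(* Past a well-order too long to inject into the sets of formulas, the sets
   [th_ge _ v] repeat, so rank [>= v] reproduces itself one level down. *)
Lemma th_undefined_coind (phi : form (csum X (carrier M))) Delta Pi k : ~ th_defined
    phi Delta Pi k ->
  exists G : set (form (csum X (carrier M))), G phi /\ forall psi, G psi ->
  (exists x : asg X M, sat psi (vjoin x (@selfval S M))) /\
  exists delta pi (c : asg Z M) (D : set (asg Y M)),
  [/\ Delta delta /\ Pi pi, infinite_set D, D `<=` [set a | sat pi (vjoin a c)],
      forall a, D a -> G (FAnd psi (inst delta a)) &
      k_inconsistent k delta [set a | sat pi (vjoin a c)]].
Proof.
move=> nd; pose F := form (csum X (carrier M)).
(* The double power set of the formulas does not inject into their power set, so [g] below repeats a
   value. *)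
have [R wR] : exists R : rel (set F -> Prop), well_order R.
  exact: ex_well_order.
have all_ge w : th_ge R phi Delta Pi k w.
  by apply: contrapT => nth; apply: nd; exists (set F -> Prop), R, w.
pose g w : set F := [set psi | th_ge R psi Delta Pi k w].
have [v [w [vw gvw]]] : exists v w, olt R v w /\ g v = g w.
  have /existsNP[v /existsNP[w /not_implyP[E nE]]] := @cantor_not_injective F g.
  have [wv|/negP wv] := pselect (R w v); last by exists v, w.
  exists w, v; split; last by [].
  by apply/negP => vw; apply: nE; exact: wo_anti vw wv.
have [u vu umin] := wo_min wR (P := olt R v) (ex_intro _ w vw).
have su : osucc R v u.
  split=> // x xu; apply: contrapT => /negP vx.
  by move/negP: xu; apply; exact: umin.
exists (g v); split=> [|psi gpsi]; first exact: all_ge.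
split; first exact: th_ge_cons gpsi.
(* Rank at least [v] is here the same as rank at least [w], and the successor [u] of [v] is at most
   [w]; the successor clause at [u] then leads back to [v]. *)
have gw : g w psi by rewrite -gvw.
have : th_ge R psi Delta Pi k u.
  by apply: (th_ge_mono (w := w)) => //; exact: umin.
move=> hu; case: hu su vu => [u' uz _|u' lu _|v' u' delta pi c D sv De Pe infD DP h kc]
    su vu.
- by move/negP: vu => []; exact: uz.
- by case: (lu.2 v).
have vv' : v' = v by apply: (wo_anti wR); [apply: su.2; case: sv|apply: sv.2; case: su].
by exists delta, pi, c, D; split=> //; rewrite -vv'.
Qed.

End Rank.

(** * Symmetry implies rosiness *)

(** In a rank [z] may be infinite, whereas compactness only provides finite tuples [c]; the formula
    [pi] mentions finitely many entries of [z]. *)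
Lemma form_support_right S (M : structure S) (Y Z : ctx S) (pi : form (csum Y Z)) :
  exists Z' (f : ctx_map Z' Z) (pi' : form (csum Y Z')), finite_ctx Z' /\
  forall (y : asg Y M) (z : asg Z M),
    sat pi (vjoin y z) <-> sat pi' (vjoin y (fun s x => z s (f s x))).
Proof.
have [W [f [pi' [Wf E]]]] := form_support M pi.
have [Z' [f' [t [Z'f tE]]]] := @ctx_map_split S Z Y W
  (fun s w => match f s w with inl y => inr y | inr z => inl z end) Wf.
exists Z', f', (rename (fun s w => match t s w with inl z => inr z | inr y => inl y
    end) pi').
split=> // y z; rewrite E; apply: iff_sym; apply: sat_rename_eq => s w.
by have := tE s w; case: (f s w) => [y'|z'] /=; case: (t s w) => // ? [->].
Qed.

Lemma elements_adjoin_countable S (M : structure S) (A : pset M) Z (c : asg Z M) :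
  finite_ctx Z -> countable (elements A) -> countable (elements (adjoin A c)).
Proof.
move=> Zf Ac.
have -> : elements (adjoin A c) = elements A `|`
    [set existT _ (projT1 p) (c (projT1 p) (projT2 p)) | p in [set: {s & Z s}]].
  apply/seteqP; split=> [[s m] [Am|[z zT zm]]|[s m] [Am|[[s' z] zT E]]].
  - by left.
  - by right; exists (existT _ s z) => //; congr existT.
  - by left.
  have Es : s' = s by case: E.
  by subst s'; right; exists z => //; exact: existT_inj E.
have -> : forall T (P Q : set T), P `|` Q = \bigcup_(b in [set: bool]) (if b then P else Q).
  move=> T P Q; apply/seteqP; split=> [x [Px|Qx]|x [[] _ ?]]; by [exists true|exists
      false|left|right].
apply: bigcup_countable => [|[] _] //.
by apply: finite_set_countable; apply: finite_image.
Qed.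

Lemma pdefinable_chain S (M : structure S) (B : nat -> pset M) (P : pset M) X (Q : asg
    X M -> Prop) :
  (forall n s, B n s `<=` B n.+1 s) -> (forall s m, P s m -> exists n, B n s m) ->
  pdefinable P Q -> exists n, pdefinable (B n) Q.
Proof.
move=> Bn PB dQ.
have Bm m n s : m <= n -> B m s `<=` B n s.
  elim: n => [|n IH]; first by rewrite leqn0 => /eqP ->.
  rewrite leq_eqVlt => /orP[/eqP -> //|]; rewrite ltnS => /IH h x /h; exact: Bn.
have [W [w [R [Wf wP dR QR]]]] := pdefinable_support dQ.
have /dep_choice[f fP] : forall p : {s & W s}, exists n, B n (projT1 p) (w _ (projT2 p)).
  by case=> s x; exact: PB.
have [n nP] : exists n, forall p, f p <= n.
  have /finite_typeP[l lP] := Wf.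
  suff [n nP] : exists n, forall p, List.In p l -> f p <= n.
    by exists n => p; exact: nP.
  elim: l {lP} => [|p l [n nP]]; first by exists 0.
  exists (maxn (f p) n) => q [<-|/nP]; rewrite leq_max ?leqnn // => ->.
  by rewrite orbT.
exists n; apply: (@pdefinable_ext _ _ _ _ (fun x => R x w)) => [x|]; first by rewrite QR.
apply: pdefinable_inst (definable_defO _ dR) => s x.
by apply: (Bm _ _ _ (nP (existT _ s x))); exact: fP.
Qed.

Lemma finite_set_enum T (D : set T) : finite_set D ->
  exists r (d : 'I_r -> T), forall x, D x -> exists j, d j = x.
Proof.
elim/Pchoice: T D => T D /finite_seqP[l ->]; exists (size l), (tnth (in_tuple l)) => x xl.
by have /tnthP[i ->] : x \in in_tuple l by []; exists i.
Qed.

Lemma dependent_choice_seq (T U : Type) (Q : T -> U -> T -> Prop) (t0 : T) :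
  (forall t, exists u t', Q t u t') ->
  exists (t : nat -> T) (u : nat -> U), t 0 = t0 /\ forall n, Q (t n) (u n) (t n.+1).
Proof.
move=> /dep_choice[u /dep_choice[t' H]].
by exists (fun n => iter n t' t0), (fun n => u (iter n t' t0)).
Qed.

Section SymmetricRosy.
Variables (S : signature) (M : structure S) (s0 : sorts S) (K : Type).
Hypothesis cpt : compact_model M K.
Hypothesis small_adjoin : forall (A : pset M) (Z : ctx S) (c : asg Z M),
  finite_ctx Z -> small K A -> small K (adjoin A c).
Hypothesis small_countable : forall A : pset M, countable (elements A) -> small K A.

(** As [d] lies in [A], all of the infinitely many conjugates of [e] over [Ac] would satisfy
    [delta(d,y)], against [k]-inconsistency. *)
Lemma thorn_divides_elem (A : pset M) X Y (delta : form (csum X Y)) (e : asg Y M) (d :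
    asg X M) :
  (forall s x, A s (d s x)) -> thorn_divides A delta e -> ~ sat delta (vjoin d e).
Proof.
move=> dA [Z [c [Zf [/infinite_many inf [k kc]]]]] de.
have [f [fi fD]] := inf k; apply: (kc f fi fD); exists d => i.
have /realizesE H := fD i; apply: (H (fun y => sat delta (vjoin d y))) => //.
apply: (@pdefinable_inst _ _ _ _ _ (fun y x => sat delta (vjoin x y))); first by move=>
    s x; left.
have := pdefinable_sub (M := M) (X' := csum Y X) (fun s v => match v with inl y => inr
    y | inr z => inl z end)
  (pdefinable_sat (M := M) (adjoin A c) delta).
apply: pdefinable_ext => u; suff -> : (fun s v => u s (match v with inl y => inr y |
    inr z => inl z end)) = vjoin (rgt u) (lft u) by [].
by apply: functional_extensionality_dep => s; apply/funext => -[].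
Qed.

(** * The limit of a sequence of non-algebraic tuples *)

Section Sequence.
Variables (X Y Z : ctx S) (delta : form (csum X Y)) (Pi : asg Y M -> asg Z M -> Prop)
    (k : nat).
Hypotheses (Xf : finite_ctx X) (Yf : finite_ctx Y) (Zf : finite_ctx Z).
Hypothesis dPi : definable (fun u : asg (csum Y Z) M => Pi (lft u) (rgt u)).
Variables (B : nat -> pset M) (c : nat -> asg Z M) (a : nat -> asg Y M) (P : nat -> asg
    X M -> Prop).
Hypothesis Bn : forall n, B n.+1 = adjoin (adjoin (B n) (c n)) (a n).
Hypothesis B0 : countable (elements (B 0)).
Hypothesis dP : forall n, pdefinable (B n) (P n).
Hypothesis Pn : forall n x, P n.+1 x -> P n x /\ sat delta (vjoin x (a n)).
Hypothesis Pcons : forall n, exists x, P n x.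
Hypothesis kc : forall n, k_inconsistent k delta (fun y => Pi y (c n)).
Hypothesis Pac : forall n, Pi (a n) (c n).
Hypothesis nac : forall n, nonalg (adjoin (B n) (c n)) (a n).

Let Bw : pset M := fun s m => exists n, @B n s m.

Let BBw n s : @B n s `<=` @Bw s.
Proof. by move=> m Bm; exists n. Qed.

Let BSn n s : @B n s `<=` @B n.+1 s.
Proof. by rewrite Bn => m Bm; left; left. Qed.

Let Ble m n s : m <= n -> @B m s `<=` @B n s.
Proof.
elim: n => [|n IH]; first by rewrite leqn0 => /eqP ->.
rewrite leq_eqVlt => /orP[/eqP -> //|]; rewrite ltnS => /IH h x /h; exact: BSn.
Qed.

Let Ple m n x : m <= n -> P n x -> P m x.
Proof.
elim: n => [|n IH]; first by rewrite leqn0 => /eqP ->.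
by rewrite leq_eqVlt => /orP[/eqP -> //|]; rewrite ltnS => /IH h /Pn[/h].
Qed.

Let aBw n s y : @Bw s (@a n s y).
Proof. by exists n.+1; rewrite Bn; right; exists y. Qed.

Let Bw_countable : countable (elements Bw).
Proof.
have -> : elements Bw = \bigcup_(n in [set: nat]) elements (B n).
  by apply/seteqP; split=> [p [n pn]|p [n _ pn]]; exists n.
apply: bigcup_countable => [|n _]; first exact: countableP.
elim: n => [|n IH] //; rewrite Bn.
by do 2 apply: elements_adjoin_countable => //.
Qed.

Let Bw_small : small K Bw.
Proof. exact: small_countable. Qed.

Lemma sequence_not_symmetric : ~ thorn_symmetric M K.
Proof.
have [b bP] : exists b, forall n, P n b.
  have [||||x xP] := cpt (B := Bw) (G := fun Q => exists n, Q = P n) Bw_small Xf.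
  - by move=> _ [n ->]; exact: pdefinable_mono (dP n).
  - by exists (P 0), 0.
  - move=> _ _ [m ->] [n ->]; exists (P (maxn m n)); split; first by exists (maxn m n).
    by move=> x h; split; apply: Ple h; rewrite ?leq_maxl ?leq_maxr.
  - by move=> _ [n ->].
  by exists x => n; apply: xP; exists n.
pose Bb := adjoin Bw b.
have Bbs : small K Bb by exact: small_adjoin.
have BwBb s : @Bw s `<=` @Bb s by left.
(* Almost all pairs, rather than all: a pair is known to be non-algebraic only over its own past,
   which must contain the parameters in question. *)
pose G (Q : asg (csum Y Z) M -> Prop) := pdefinable Bb Q /\
   exists n0, forall n, n0 <= n -> Q (vjoin (a n) (c n)).
have [||||u uP] := cpt (B := Bb) (G := G) Bbs (finite_csum Yf Zf).
- by move=> Q [].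
- by exists (fun _ => True); split; [exact: (pdefinable_cst s0)|exists 0].
- move=> Q R [dQ [n nQ]] [dR [m mR]]; exists (fun u => Q u /\ R u); split=> //.
  split; first exact: pdefinable_and.
  by exists (maxn n m) => i; rewrite geq_max => /andP[/nQ ? /mR].
- by move=> Q [_ [n nQ]]; exists (vjoin (a n) (c n)); exact: nQ.
have uall (Q : asg (csum Y Z) M -> Prop) : pdefinable Bb Q -> (forall n, Q (vjoin (a n)
    (c n))) -> Q u.
  by move=> dQ H; apply: uP; split=> //; exists 0.
have uex (Q : asg (csum Y Z) M -> Prop) n0 : pdefinable Bb Q -> Q u ->
    exists2 n, n0 <= n & Q (vjoin (a n) (c n)).
  move=> dQ Qu; apply: contrapT => H; have := uP (fun u => ~ Q u); apply=> //.
  split; first exact: pdefinable_not.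
  by exists n0 => n nn Qn; apply: H; exists n.
pose as_ := lft u; pose cs := rgt u.
have Pis : Pi as_ cs.
  by apply: (uall (fun u => Pi (lft u) (rgt u))) => //; exact: definable_defO.
have kcs : k_inconsistent k delta (fun y => Pi y cs).
  apply: (uall (fun u => k_inconsistent k delta (fun y => Pi y (rgt u)))) => //.
  apply: (pdefinable_kinc s0 k delta (D := fun u y => Pi y (rgt u))) => //.
  exact: (pdefinable_sub (X' := csum (csum Y Z) Y) (fun s (v : csum Y Z s) =>
    match v with inl y => inr y | inr z => inl (inr z) end) (definable_defO Bb dPi)).
have ds : sat delta (vjoin b as_).
  apply: (uall (fun u => sat delta (vjoin b (lft u)))); last first.
    by move=> n; have [] := Pn (bP n.+1).
  apply: (@pdefinable_inst _ _ _ _ _ (fun u x => sat delta (vjoin x (lft u)))).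
    by move=> s x; right; exists x.
  have := pdefinable_sub (M := M) (X' := csum (csum Y Z) X) (fun s (v : csum X Y s) =>
    match v with inl y => inr y | inr z => inl (inl z) end) (pdefinable_sat (M := M) Bb
        delta).
  apply: pdefinable_ext => v; suff -> : (fun s w => v s (match w with inl y => inr y |
      inr z => inl (inl z) end)) = vjoin (rgt v) (lft (lft v)) by [].
  by apply: functional_extensionality_dep => s; apply/funext => -[].
have nas : nonalg (adjoin Bw cs) as_.
  (* The parameters of [Q] lie in some [B n0]. A bound on the number of solutions would hold at some
     pair beyond [n0], against its non-algebraicity. *)
  move=> Q0 /pdefinable_adjoin[Q [dQ Q0Q]] /Q0Q Qas N; apply: contrapT => nN.
  have [n0 dQn] := pdefinable_chain BSn (fun s m (h : @Bw s m) => h) dQ.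
  have [||n nn [Qn nNn]] := uex (fun u => Q (lft u) (rgt u) /\ ~ many N (fun y => Q y
      (rgt u))) n0.
  - apply: pdefinable_and; first exact: pdefinable_mono dQ.
    apply: pdefinable_not; apply: (pdefinable_many s0 _ (P := fun u y => Q y (rgt u)))
        => //.
    exact: (pdefinable_sub (X' := csum (csum Y Z) Y) (fun s (v : csum Y Z s) =>
      match v with inl y => inr y | inr z => inl (inr z) end) (pdefinable_mono BwBb dQ)).
  - by split=> // h; apply: nN; apply: many_sub h => y /Q0Q.
  apply: nNn; apply: (nac (n := n) (P := fun y => Q y (c n))) => //.
  by apply: pdefinable_inst_adjoin; apply: pdefinable_mono dQn => s; exact: Ble.
have div : thorn_divides Bw delta as_.
  exists Z, cs; split=> //; apply/(strongly_dividesE s0 cpt small_adjoin) => //.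
    exact: small_adjoin.
  split=> //; exists k, (fun y => Pi y cs); split=> //.
  by apply: pdefinable_inst_adjoin; exact: definable_defO.
move=> /(_ X Y b as_ Bw Xf Yf Bw_small)[_ sym].
have fork : type_thorn_forks Bw (tp (adjoin Bw as_) b).
  exists (inst delta as_); split.
    move=> x /realizesE bx; apply/sat_inst; apply: (bx (fun x => sat delta (vjoin x
        as_))) => //.
    apply: (@pdefinable_inst_adjoin _ M Bw X Y as_ (fun x y => sat delta (vjoin x y)));
        apply: pdefinable_ext (pdefinable_sat (M := M) Bw delta) => v.
    by rewrite vjoinK.
  exists 1, (fun _ => Y), (fun _ => delta), (fun _ => as_); split=> [_|x /sat_inst dx] //.
  by exists ord0.
have {sym}[phi [tphi [n [Yd [dl [d [dlP phidl]]]]]]] :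
    type_thorn_forks Bw (tp (adjoin Bw b) as_).
  by apply: contrapT => nf; exact: (sym nf fork).
pose dd : asg (cbig Yd) M := fun s p => d (projT1 p) s (projT2 p).
have ddf : finite_ctx (cbig Yd).
  by apply: finite_cbig => [|i]; [exact: finite_type_ord|have [] := dlP i].
have ddD i s y : adjoin Bb dd s (d i s y) by right; exists (existT _ i y).
(* Finite parts are realized by some [a m], which lies in [Bw] and hence satisfies no formula that
   thorn-divides over [Bw]. *)
pose H (Q : asg Y M -> Prop) (x : asg Y M) := Q x /\ forall i, ~ sat (dl i) (vjoin x (d i)).
have [||||x xP] := cpt (B := adjoin Bb dd)
  (G := fun R => exists Q, [/\ pdefinable Bb Q, Q as_ & R = H Q]) (small_adjoin ddf Bbs) Yf.
- move=> _ [Q [dQ Qas ->]]; apply: pdefinable_and.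
    by apply: pdefinable_mono dQ => s m; left.
  apply: (pdefinable_all s0) => [|i]; first exact: finite_type_ord.
  apply: pdefinable_not; apply: (@pdefinable_inst _ _ _ _ _ (fun x y => sat (dl i)
      (vjoin x y))) => //.
  by apply: pdefinable_ext (pdefinable_sat (M := M) (adjoin Bb dd) (dl i)) => v;
      rewrite vjoinK.
- by exists (H (fun _ => True)), (fun _ => True); split=> //; exact: (pdefinable_cst s0).
- move=> _ _ [Q [dQ Qas ->]] [R [dR Ras ->]]; exists (H (fun x => Q x /\ R x)).
  split; last by move=> x [[? ?] ?]; split; split.
  by exists (fun x => Q x /\ R x); split=> //; exact: pdefinable_and.
- move=> _ [Q [dQ Qas ->]].
  have [||m _ Qam] := uex (fun u => Q (lft u)) 0 => //.
    exact: (pdefinable_sub (X' := csum Y Z) (fun s => inl) dQ).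
  exists (a m); split=> // i; have [_ di] := dlP i.
  exact: thorn_divides_elem di.
have [i] : exists i, sat (dl i) (vjoin x (d i)).
  apply: phidl; apply: tphi; apply/realizesE => Q dQ Qas.
  by have [] := xP (H Q); first by exists Q.
have [|_] := xP (H (fun _ => True)); last exact.
by exists (fun _ => True); split=> //; exact: (pdefinable_cst s0).
Qed.

End Sequence.

Lemma symmetric_rosy : thorn_symmetric M K -> rosy M.
Proof.
move=> sym X Y Z phi Delta Pi k Xf Yf Deltaf Pif; apply: contrapT.
move=> /th_undefined_coind[G [Gphi GP]].
have [r [d dP]] := finite_set_enum (finite_setX Deltaf Pif).
have /dep_choice[Z' /dep_choice[f /dep_choice[pi' piP]]] :=
  fun j => form_support_right M (d j).2.
pose Pj j (y : asg Y M) (z : asg (Z' j) M) := sat (pi' j) (vjoin y z).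
pose dl j := (d j).1.
pose A : pset M := fun _ => set0.
have Zf j : finite_ctx (Z' j) by have [] := piP j.
have dPj j : pdefinable A (fun u : asg (csum Y (Z' j)) M => Pj j (lft u) (rgt u)).
  by apply: pdefinable_ext (pdefinable_sat (M := M) A (pi' j)) => u; rewrite /Pj vjoinK.
(* [G] reproduces itself below each of its members, so trees of every depth grow from it. *)
have richG psi : G psi -> rich dl Pj (fun _ => k) (fun _ => True)
    (fun x => sat psi (vjoin x (@selfval S M))).
  move=> Gpsi n N; elim: n psi Gpsi => [|n IH] psi Gpsi; first by have [] := GP _ Gpsi.
  have [_ [delta [pi [c [D [[De Pe] infD DP GD kc]]]]]] := GP _ Gpsi.
  have [j dj] := dP (delta, pi) (conj De Pe).
  pose c' : asg (Z' j) M := fun s x => c s (f j s x).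
  have piE y : Pj j y c' <-> sat pi (vjoin y c).
    by have [_ /(_ y c)] := piP j; rewrite dj => h; exact: iff_sym.
  have dlE : dl j = delta by rewrite /dl dj.
  exists j; split=> //; exists c'; rewrite dlE; split.
    by apply: k_inconsistent_sub kc => y /piE.
  have /infinite_many/(_ N.+1) := infD; apply: many_sub => y Dy.
  split; first by apply/piE; exact: DP.
  by apply: tree_sub (IH _ (GD y Dy)) => x [psix /sat_inst].
have [j rj] := rich_color (richG _ Gphi).
(* Countability keeps every stage small, and also the union of all the stages. *)
pose ok (p : pset M * (asg X M -> Prop)) := [/\ countable (elements p.1), pdefinable
    p.1 p.2 &
  rich dl Pj (fun _ => k) (fun i => i = j) p.2].
have ok0 : ok (A, fun _ => True).
  split=> /=; first by rewrite (_ : elements A = set0) //; apply/seteqP; split=> // -[].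
    exact: (pdefinable_cst s0).
  by move=> n N; apply: tree_sub (rj n N).
pose Q (t : {p | ok p}) (u : asg (Z' j) M * asg Y M) (t' : {p | ok p}) :=
  [/\ (sval t').1 = adjoin (adjoin (sval t).1 u.1) u.2,
      (sval t').2 = (fun x => (sval t).2 x /\ sat (dl j) (vjoin x u.2)),
      k_inconsistent k (dl j) (fun y => Pj j y u.1), Pj j u.2 u.1 &
      nonalg (adjoin (sval t).1 u.1) u.2].
have step t : exists u t', Q t u t'.
  case: t => [[B P] [/= Bc dP' rP]].
  have [c [a [kc Pc ne ra]]] := rich_step s0 Xf (fun _ => Yf) Zf dPj cpt
      (small_countable Bc)
    (fun s m (h : A s m) => match h with end) dP' rP.
  have ok' : ok (adjoin (adjoin B c) a, fun x => P x /\ sat (dl j) (vjoin x a)).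
    split=> //=; first by do 2 apply: elements_adjoin_countable => //.
    apply: pdefinable_and; first by apply: pdefinable_mono dP' => s m Bm; left; left.
    apply: (@pdefinable_inst_adjoin _ M (adjoin B c) X Y a (fun x y => sat (dl j)
        (vjoin x y))).
    apply: pdefinable_ext (pdefinable_sat (M := M) (adjoin B c) (dl j)) => v.
    by rewrite vjoinK.
  by exists (c, a), (exist _ _ ok'); split.
have [t [u [t0 tQ]]] := dependent_choice_seq (exist _ _ ok0) step.
have tok n : ok (sval (t n)) by exact: svalP.
apply: (@sequence_not_symmetric X Y (Z' j) (dl j) (Pj j) k Xf Yf (Zf j) _
  (fun n => (sval (t n)).1) (fun n => (u n).1) (fun n => (u n).2) (fun n => (sval (t
      n)).2)) => //.
- by exists (pi' j) => v; rewrite /Pj vjoinK.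
- by move=> n; have [] := tQ n.
- by rewrite t0 /=; have [] := ok0.
- by move=> n; have [] := tok n.
- by move=> n x; have [_ -> _ _ _] := tQ n.
- by move=> n; have [_ _ /(_ 0 0)] := tok n.
- by move=> n; have [] := tQ n.
- by move=> n; have [] := tQ n.
- by move=> n; have [] := tQ n.
Qed.

End SymmetricRosy.

(** * Rosiness implies symmetry *)

Lemma many_pigeonhole T r m (D : T -> Prop) (C : 'I_r -> T -> Prop) :
  (forall x, D x -> exists i, C i x) -> many (r * m).+1 D ->
  exists i, many m.+1 (fun x => D x /\ C i x).
Proof.
elim: r D C => [|r IH] D C DC.
  by move=> /many1[x /DC[[]]].
rewrite mulSn -addnS => h.
have [||{}h] := many_split (P := C ord0) (Q := fun x => exists i, C (lift ord0 i) x) _ h.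
- move=> x /DC[i]; case: (unliftP ord0 i) => [j|] -> ?; by [right; exists j|left].
- by exists ord0.
have [|i hi] := IH (fun x => D x /\ exists i, C (lift ord0 i) x) (fun i => C (lift ord0
    i)) _ h.
  by move=> x [].
by exists (lift ord0 i); apply: many_sub hi => x [[]].
Qed.

(** * Avoiding thorn-dividing formulas *)

Section Avoidance.
Variables (S : signature) (M : structure S) (s0 : sorts S) (K : Type).
Hypothesis cpt : compact_model M K.
Hypothesis small_adjoin : forall (A : pset M) (Z : ctx S) (c : asg Z M),
  finite_ctx Z -> small K A -> small K (adjoin A c).
Implicit Types (A B D : pset M) (X Y Z W : ctx S).

(** The trace over [D] of non-forking over [A]: it concerns single dividing formulas with parameters
    in [D], one at a time. *)
Definition avoids A D X (x : asg X M) := forall Y (delta : form (csum X Y)) (e : asg Y M),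
  finite_ctx Y -> (forall s y, @D s (@e s y)) -> thorn_divides A delta e ->
  ~ sat delta (vjoin x e).

Record instance X := Instance {
  ictx : ctx S; iform : form (csum X ictx); itup : asg ictx M }.
Arguments iform {X} i.
Arguments itup {X} i.

(** If the type of [a] were inconsistent with the negations of all dividing instances over [D], by
    compactness it would imply a finite disjunction of them, and so would thorn-fork. *)
Lemma nonforking_avoids A B D X (a : asg X M) : small K D -> finite_ctx X ->
  (forall s, @B s `<=` @D s) -> ~ type_thorn_forks A (tp B a) ->
  exists a', eqtp B a a' /\ avoids A D a'.
Proof.
move=> Ds Xf BD nf.
pose valid (f : instance X) := [/\ finite_ctx (ictx f), forall s y, @D s (itup f s y) &
  thorn_divides A (iform f) (itup f)].
pose F (Q : asg X M -> Prop) n (d : 'I_n -> instance X) (x : asg X M) :=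
  Q x /\ forall i, ~ sat (iform (d i)) (vjoin x (itup (d i))).
pose G R := exists Q n (d : 'I_n -> instance X),
  [/\ pdefinable B Q, Q a, forall i, valid (d i) & R = F Q n d].
have d0 : 'I_0 -> instance X by case.
have G0 (Q : asg X M -> Prop) : pdefinable B Q -> Q a -> G (F Q 0 d0).
  by move=> dQ Qa; exists Q, 0, d0; split=> // -[].
have [||||x xP] := cpt (B := D) (G := G) Ds Xf.
- move=> _ [Q [n [d [dQ Qa dv ->]]]]; apply: pdefinable_and; first exact:
    pdefinable_mono dQ.
  apply: (pdefinable_all s0) => [|i]; first exact: finite_type_ord.
  have [_ di _] := dv i.
  apply: pdefinable_not; apply: (@pdefinable_inst _ _ _ _ _ (fun x y => sat (iform (d
      i)) (vjoin x y))) => //.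
  by apply: pdefinable_ext (pdefinable_sat (M := M) D (iform (d i))) => v; rewrite vjoinK.
- by eexists; apply: (G0 (fun _ => True)) => //; exact: (pdefinable_cst s0).
- move=> _ _ [Q [n [d [dQ Qa dv ->]]]] [Q' [n' [d' [dQ' Q'a dv' ->]]]].
  pose d2 (i : 'I_(n + n')) := match fintype.split i with inl i => d i | inr i => d' i end.
  exists (F (fun x => Q x /\ Q' x) (n + n') d2); split.
    exists (fun x => Q x /\ Q' x), (n + n'), d2; split=> //; first exact: pdefinable_and.
    by move=> i; rewrite /d2; case: (fintype.split i).
  move=> x [[Qx Q'x] H]; split; split=> // i.
    by have := H (unsplit (inl i)); rewrite /d2 unsplitK.
  by have := H (unsplit (inr i)); rewrite /d2 unsplitK.
- move=> _ [Q [n [d [dQ Qa dv ->]]]]; apply: contrapT => nF; apply: nf.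
  have [phi phiE] : definable (fun v : asg (csum X (carrier M)) M =>
      ~ forall i, ~ sat (inst (iform (d i)) (itup (d i))) v).
    apply: definable_not; apply: (definable_all s0); first exact: finite_type_ord.
    by move=> i; apply: definable_not; exists (inst (iform (d i)) (itup (d i))).
  exists phi; split.
    move=> x /realizesE ax; apply/phiE => H; apply: nF; exists x.
    split; first exact: (ax Q dQ Qa).
    by move=> i /sat_inst; exact: H.
  exists n, (fun i => ictx (d i)), (fun i => iform (d i)), (fun i => itup (d i)).
  split=> [i|x /phiE/existsNP[i /contrapT/sat_inst]]; last by exists i.
  by have [] := dv i.
exists x; split=> [P dP Pa|Y delta e Yf eD div]; first by have [] := xP _ (G0 P dP Pa).
pose f := @Instance X Y delta e.
have [|_ /(_ ord0)] := xP (F (fun _ => True) 1 (fun _ => f)); last exact.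
exists (fun _ => True), 1, (fun _ => f); split=> //; exact: (pdefinable_cst s0).
Qed.

(** Suppose [Q(y,x)], true of [e], has fewer than [N] solutions [y]. As a formula in [x] this makes
    [e] one of fewer than [N] points, so [N] distinct conjugates of [e] over [Aw] give inconsistent
    instances: a formula true of [x] thorn-divides over [A], with [w] as witness. *)
Lemma nonalg_indep A D W (w : asg W M) Y (e : asg Y M) X (x : asg X M) :
  small K A -> finite_ctx W -> finite_ctx Y -> finite_ctx X ->
  (forall s, @A s `<=` @D s) -> (forall s y, @D s (@w s y)) -> (forall s y, @D s (@e s
      y)) ->
  avoids A D x -> nonalg (adjoin A w) e -> nonalg (adjoin (adjoin A w) x) e.
Proof.
move=> As Wf Yf Xf AD wD eD av ne P /pdefinable_adjoin[Q [dQ PQ]] /PQ Qe N.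
apply: contrapT => nN.
have N0 : 0 < N.
  rewrite lt0n; apply/eqP => N0; apply: nN; rewrite N0.
  by exists (fun _ => e); split=> -[].
(* The finitely many parameters [v] of [Q] are moved to the side of [y], since [delta] itself must
   be free of parameters. *)
have [V [v [R [Vf vF dR QR]]]] := pdefinable_support dQ.
have {}QR y x' : Q y x' <-> R (vjoin y x') v by rewrite -QR.
pose E : pset M := fun _ => set0.
pose T (x' : asg X M) (u : asg (csum Y V) M) :=
  R (vjoin (lft u) x') (rgt u) /\ ~ many N (fun y => R (vjoin y x') (rgt u)).
have [delta deltaE] : definable (fun t : asg (csum X (csum Y V)) M => T (lft t) (rgt t)).
  apply: (@pdefinable_empty_definable _ _ E) => //.
  pose swap s (z : csum (csum Y X) V s) : csum X (csum Y V) s := match z with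
    | inl (inl y) => inr (inl y) | inl (inr x) => inl x | inr v => inr (inr v) end.
  apply: pdefinable_and.
    apply: pdefinable_ext (pdefinable_sub (X' := csum X (csum Y V)) swap
        (definable_defO E dR)) => t.
    suff -> : lft (fun s z => t s (swap s z)) = vjoin (lft (rgt t)) (lft t) by [].
    by apply: functional_extensionality_dep => s; apply/funext => -[].
  apply: pdefinable_not; apply: (pdefinable_many s0 _ (P := fun t y => R (vjoin y (lft
      t)) (rgt (rgt t)))) => //.
  pose swap' s (z : csum (csum Y X) V s) : csum (csum X (csum Y V)) Y s := match z with
    | inl (inl y) => inr y | inl (inr x) => inl (inl x) | inr v => inl (inr (inr v)) end.
  apply: pdefinable_ext (pdefinable_sub (X' := csum (csum X (csum Y V)) Y) swap'
      (definable_defO E dR)) => t.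
  suff -> : lft (fun s z => t s (swap' s z)) = vjoin (rgt t) (lft (lft t)) by [].
  by apply: functional_extensionality_dep => s; apply/funext => -[].
have YVf := finite_csum Yf Vf.
have FD s m : adjoin A w s m -> @D s m by case=> [/AD|[z _ <-]].
apply: (av (csum Y V) delta (vjoin e v)) => //.
- by move=> s [y|z] //=; apply: FD; exact: vF.
- exists W, w; split=> //; apply/(strongly_dividesE s0 cpt small_adjoin) => //.
    exact: small_adjoin.
  split.
    move=> P' dP' P'e n.
    have [|f [fi fP]] := ne (fun y => P' (vjoin y v)) _ P'e n.
      apply: (@pdefinable_inst _ _ _ _ _ (fun y v => P' (vjoin y v))) => //.
      by apply: pdefinable_ext dP' => u; rewrite vjoinK.
    by exists (fun i => vjoin (f i) v); split=> // i j /vjoin_inj[/fi].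
  (* Fixing the second component to [v] forces distinct tuples to differ in the first. *)
  exists N, (fun u => rgt u = v); split=> //.
    apply: (@pdefinable_sub _ _ _ _ (csum Y V) (fun s => inr) (fun y => y = v)).
    exact: pdefinable_eq_tuple.
  move=> f fi fv [x' xf].
  have H i : T x' (f i) by apply/(deltaE (vjoin x' (f i))).
  have [_] := H (Ordinal N0); apply; exists (fun i => lft (f i)); split.
    by move=> i j E'; apply: fi; rewrite -(vjoinK (f i)) -(vjoinK (f j)) E' !fv.
  by move=> i; have [] := H i; rewrite !fv.
apply/deltaE; split; first exact/QR.
by move=> h; apply: nN; apply: many_sub h => y /QR/PQ.
Qed.

End Avoidance.

(** * Non-forking over the domain, and independent chains *)

Section Nonforking.
Variables (S : signature) (M : structure S) (s0 : sorts S) (K : Type).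
Hypothesis cpt : compact_model M K.
Hypothesis small_adjoin : forall (A : pset M) (Z : ctx S) (c : asg Z M),
  finite_ctx Z -> small K A -> small K (adjoin A c).
Implicit Types (A B D : pset M) (X Y Z W : ctx S).

Lemma thorn_divides_data A X r (Y : 'I_r -> ctx S) (delta : forall i, form (csum X (Y i)))
    (e : forall i, asg (Y i) M) : small K A -> finite_ctx X ->
  (forall i, finite_ctx (Y i) /\ thorn_divides A (delta i) (e i)) ->
  exists (Z : 'I_r -> ctx S) (c : forall i, asg (Z i) M)
    (Pi : forall i, asg (Y i) M -> asg (Z i) M -> Prop) (k : 'I_r -> nat), forall i,
  (finite_ctx (Z i) /\ pdefinable A (fun u : asg (csum (Y i) (Z i)) M => Pi i (lft u)
      (rgt u))) /\
  [/\ Pi i (e i) (c i), k_inconsistent (k i) (delta i) (fun y => Pi i y (c i)) &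
      nonalg (adjoin A (c i)) (e i)].
Proof.
move=> As Xf H.
suff /dep_choice[Z /dep_choice[c /dep_choice[Pi /dep_choice[k kP]]]] : forall i,
    exists Z (c : asg Z M) (Pi : asg (Y i) M -> asg Z M -> Prop) k,
  (finite_ctx Z /\ pdefinable A (fun u : asg (csum (Y i) Z) M => Pi (lft u) (rgt u))) /\
  [/\ Pi (e i) c, k_inconsistent k (delta i) (fun y => Pi y c) &
      nonalg (adjoin A c) (e i)].
  by exists Z, c, Pi, k.
move=> i; have [Yf [Z [c [Zf]]]] := H i.
move=> /(strongly_dividesE s0 cpt small_adjoin _ _ (small_adjoin Zf As) Xf Yf).
move=> [ne [k [P [/pdefinable_adjoin[Q [dQ PQ]] /PQ Pe kc]]]].
exists Z, c, Q, k; split=> //; split=> //.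
by apply: k_inconsistent_sub kc => y /PQ.
Qed.

Section Family.
Variables (r : nat) (X : ctx S) (Y Z : 'I_r -> ctx S).
Variables (delta : forall j, form (csum X (Y j))).
Variables (Pi : forall j, asg (Y j) M -> asg (Z j) M -> Prop) (k : 'I_r -> nat).
Hypotheses (Xf : finite_ctx X) (Yf : forall j, finite_ctx (Y j))
  (Zf : forall j, finite_ctx (Z j)).
Variable A : pset M.
Hypothesis dPi : forall j, pdefinable A (fun u : asg (csum (Y j) (Z j)) M => Pi (lft u)
    (rgt u)).

(** Having a tree of height [n] below it is definable over [Bc] and true of [e], hence of
    arbitrarily many tuples, as [e] is non-algebraic. *)
Lemma tree_nonalg B J n N (P : asg X M -> Prop) j (c : asg (Z j) M) (e : asg (Y j) M) :
  (forall s, @A s `<=` @B s) -> pdefinable B P -> J j ->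
  k_inconsistent (k j) (delta j) (fun y => Pi y c) -> Pi e c -> nonalg (adjoin B c) e ->
  tree delta Pi k J n N (fun x => P x /\ sat (delta j) (vjoin x e)) ->
  tree delta Pi k J n.+1 N P.
Proof.
move=> AB dP Jj kc Pe ne te; exists j; split=> //; exists c; split=> //.
apply: (ne (fun a => Pi a c /\ tree delta Pi k J n N (fun x => P x /\ sat (delta j)
    (vjoin x a)))) => //.
apply: pdefinable_and.
  by apply: pdefinable_inst_adjoin; exact: pdefinable_mono (dPi j).
apply: pdefinable_mono (@adjoin_sub _ _ B _ c) _.
apply: (pdefinable_tree s0 delta k Xf Yf Zf dPi _ n N (P := fun a x => P x /\ sat
    (delta j) (vjoin x a))) => //.
apply: pdefinable_and; last exact: (pdefinable_delta _ _ (U := csum (Y j) X) (fun s =>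
    inr) (fun s => inl)).
exact: (pdefinable_sub (X' := csum (Y j) X) (fun s => inr) dP).
Qed.

(** Leaves are coloured by the [C i]. A node has more than [q * N] children, so more than [N] of
    them lead to subtrees of one colour. *)
Lemma tree_leaf J n q N (P : asg X M -> Prop) (C : 'I_q -> asg X M -> Prop) :
  (forall x, P x -> exists i, C i x) -> tree delta Pi k J n (q * N) P ->
  exists i, tree delta Pi k J n N (fun x => P x /\ C i x).
Proof.
elim: n P => [|n IH] P PC; first by case=> x Px; have [i Cx] := PC x Px; exists i, x.
move=> [j [Jj [c [kc h]]]].
have [|i hi] := many_pigeonhole (C := fun i a => tree delta Pi k J n N
   (fun x => (P x /\ sat (delta j) (vjoin x a)) /\ C i x)) _ h.
  by move=> a [_ /IH]; apply=> x [/PC].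
exists i; exists j; split=> //; exists c; split=> //.
apply: many_sub hi => a [[Pa _] ta]; split=> //.
by apply: tree_sub ta => x [[? ?] ?]; split.
Qed.

End Family.

(** Otherwise some formula [P] of the type implies a disjunction of dividing instances. Colouring
    the leaves of a tree for [P] by the disjunct that they satisfy puts a tree inside one instance,
    and [tree_nonalg] places a new root above it. Hence [P] is rich. *)
Lemma rosy_nonforking A X (e : asg X M) : rosy M -> small K A -> finite_ctx X ->
  ~ type_thorn_forks A (tp A e).
Proof.
move=> rM As Xf [phi [tphi [r [Y [delta [d [dP phid]]]]]]].
have [Z [c [Pi [k H]]]] := thorn_divides_data As Xf dP.
have Yf i : finite_ctx (Y i) by have [] := dP i.
have Zf i : finite_ctx (Z i) by have [[]] := H i.
have dPi i : pdefinable A (fun u : asg (csum (Y i) (Z i)) M => Pi i (lft u) (rgt u)).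
  by have [[]] := H i.
pose dd : asg (cbig Y) M := fun s p => d (projT1 p) s (projT2 p).
have ddf : finite_ctx (cbig Y) by apply: finite_cbig => //; exact: finite_type_ord.
have [P [dPO [Pe PC]]] : exists P, pdefinable A P /\ P e /\
    forall x, P x -> exists i, sat (delta i) (vjoin x (d i)).
  apply: contrapT => nP.
  pose F (Q : asg X M -> Prop) x := Q x /\ forall i, ~ sat (delta i) (vjoin x (d i)).
  have [||||x xP] := cpt (B := adjoin A dd)
    (G := fun R => exists Q, [/\ pdefinable A Q, Q e & R = F Q]) (small_adjoin ddf As) Xf.
  - move=> _ [Q [dQ Qe ->]]; apply: pdefinable_and; first exact: (pdefinable_mono
      (@adjoin_sub _ _ A _ dd) dQ).
    apply: (pdefinable_all s0) => [|i]; first exact: finite_type_ord.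
    apply: pdefinable_not; apply: (@pdefinable_inst _ _ _ _ _ (fun x y => sat (delta i)
        (vjoin x y))).
      by move=> s y; right; exists (existT _ i y).
    by apply: pdefinable_ext (pdefinable_sat (M := M) (adjoin A dd) (delta i)) => v;
        rewrite vjoinK.
  - by exists (F (fun _ => True)), (fun _ => True); split=> //; exact: (pdefinable_cst s0).
  - move=> _ _ [Q [dQ Qe ->]] [R [dR Re ->]]; exists (F (fun x => Q x /\ R x)).
    split; last by move=> x [[? ?] ?]; split; split.
    by exists (fun x => Q x /\ R x); split=> //; exact: pdefinable_and.
  - move=> _ [Q [dQ Qe ->]]; apply: contrapT => nF; apply: nP; exists Q; split=> //.
    split=> // x Qx; apply: contrapT => nx; apply: nF; exists x; split=> // i dx.
    by apply: nx; exists i.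
  have [i] : exists i, sat (delta i) (vjoin x (d i)).
    apply: phid; apply: tphi; apply/realizesE => Q dQ Qe.
    by have [] := xP (F Q); first by exists Q.
  have [|_] := xP (F (fun _ => True)); last exact.
  by exists (fun _ => True); split=> //; exact: (pdefinable_cst s0).
have rP : rich delta Pi k (fun _ => True) P.
  move=> n; elim: n => [|n IH] N; first by exists e.
  have [i ti] := tree_leaf PC (IH (r * N)).
  have [_ [Pi_i kc ne]] := H i.
  exact: (tree_nonalg Xf Yf Zf dPi (fun _ _ h => h) dPO _ kc Pi_i ne ti).
apply: (rosy_not_rich s0 Xf Yf Zf dPi cpt small_adjoin rM As) => n N.
exact: tree_sub (rP n N).
Qed.

Section Chain.
Variables (r : nat) (Y : ctx S) (Yd Z : 'I_r -> ctx S).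
Let E : ctx S := csum (cbig Yd) (cbig Z).
Hypotheses (Yf : finite_ctx Y) (Ef : finite_ctx E) (Ydf : forall j, finite_ctx (Yd j))
  (Zf : forall j, finite_ctx (Z j)).
Variable ok : asg (csum Y E) M -> Prop.

Definition dpart j (u : asg E M) : asg (Yd j) M := fun s y => u s (inl (existT (fun i
    => Yd i s) j y)).
Definition cpart j (u : asg E M) : asg (Z j) M := fun s y => u s (inr (existT (fun i =>
    Z i s) j y)).

Arguments dpart : clear implicits.
Arguments cpart : clear implicits.

(* Lists are built from the tail to the head: the parameters of an element stay
   non-algebraic over everything added to its left. *)
Fixpoint indep_chain B (l : seq (asg (csum Y E) M)) : Prop :=
  if l is u :: l' then [/\ ok u,
    forall j, nonalg (adjoin B (cpart j (rgt u))) (dpart j (rgt u)) &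
    indep_chain (adjoin B u) l'] else True.

(** Each link is an application of [nonalg_indep]. The tuple [w] collects the links already passed,
    while dividing is measured over the fixed [A]. *)
Lemma indep_chain_adjoin A D W (w : asg W M) V (x : asg V M) l :
  small K A -> finite_ctx W -> finite_ctx V ->
  (forall s, @A s `<=` @D s) -> (forall s y, @D s (@w s y)) ->
  (forall u, List.In u l -> forall s y, @D s (u s y)) ->
  avoids A D x -> indep_chain (adjoin A w) l -> indep_chain (adjoin (adjoin A w) x) l.
Proof.
move=> As Wf Vf AD wD lD av.
elim: l W w Wf wD lD => [|u l IH] W w Wf wD lD //= [oku nu cl].
have uD := lD u (or_introl erefl).
split=> // [j|].
  rewrite (adjoinAC (adjoin A w) x) (adjoin_vjoin A w).
  apply: (nonalg_indep s0 cpt small_adjoin (D := D)) => //.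
  - exact: finite_csum.
  - by move=> s [y|z] /=; [exact: wD|exact: uD].
  - by move=> s y; exact: uD.
  - by rewrite -adjoin_vjoin; exact: nu.
rewrite (adjoinAC (adjoin A w) x) (adjoin_vjoin A w); apply: IH.
- by apply: finite_csum => //; exact: finite_csum.
- by move=> s [y|z] /=; [exact: wD|exact: uD].
- by move=> v vl; apply: lD; right.
- by rewrite -adjoin_vjoin.
Qed.

End Chain.
End Nonforking.

Section RosySymmetric.
Variables (S : signature) (M : structure S) (s0 : sorts S) (K : Type).
Hypothesis cpt : compact_model M K.
Hypothesis small_adjoin : forall (A : pset M) (Z : ctx S) (c : asg Z M),
  finite_ctx Z -> small K A -> small K (adjoin A c).
Implicit Types (A B D : pset M) (X Y Z W : ctx S).
Arguments dpart {S M r Yd Z} j u s _.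
Arguments cpart {S M r Yd Z} j u s _.

Lemma small_cover U B (l : seq (asg U M)) : finite_ctx U -> small K B ->
  exists D, [/\ small K D, forall s, @B s `<=` @D s &
    forall u, List.In u l -> forall s x, @D s (u s x)].
Proof.
move=> Uf Bs; elim: l => [|u l [D [Ds BD lD]]]; first by exists B; split=> [|s m|u []].
exists (adjoin D u); split; first exact: small_adjoin.
  by move=> s m /BD; left.
by move=> v [<-|vl] s x; [right; exists x|left; exact: lD].
Qed.

Lemma rosy_fork_sym X Y (a : asg X M) (b : asg Y M) A : rosy M ->
  finite_ctx X -> finite_ctx Y -> small K A ->
  type_thorn_forks A (tp (adjoin A a) b) -> type_thorn_forks A (tp (adjoin A b) a).
Proof.
move=> rM Xf Yf As [phi [tphi [r [Yd [delta [d [dP phid]]]]]]].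
apply: contrapT => nf.
have [Z [c [Pi [k H]]]] := thorn_divides_data s0 cpt small_adjoin As Yf dP.
have Ydf i : finite_ctx (Yd i) by have [] := dP i.
have Zf i : finite_ctx (Z i) by have [[]] := H i.
have dPi i : pdefinable A (fun u : asg (csum (Yd i) (Z i)) M => Pi i (lft u) (rgt u)).
  by have [[]] := H i.
pose E : ctx S := csum (cbig Yd) (cbig Z).
have Ef : finite_ctx E.
  by apply: finite_csum; apply: finite_cbig => //; exact: finite_type_ord.
pose e : asg E M := vjoin (fun s (p : cbig Yd s) => d (projT1 p) s (projT2 p))
  (fun s (p : cbig Z s) => c (projT1 p) s (projT2 p)).
(* Only the first component of a copy of [(a,e)] is tied to [b]; the second need not have the type
   of [e] over [Aab]. *)
pose ok (u : asg (csum X E) M) :=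
  eqtp A (vjoin a e) u /\ eqtp A (vjoin a b) (vjoin (lft u) b).
have dcpart (u v : asg (csum X E) M) j : eqtp A u v -> eqtp A
    (vjoin (dpart j (rgt u)) (cpart j (rgt u))) (vjoin (dpart j (rgt v)) (cpart j (rgt v))).
  pose f s (z : csum (Yd j) (Z j) s) : csum X E s := match z with
    | inl y => inr (inl (existT (fun i => Yd i s) j y))
    | inr z => inr (inr (existT (fun i => Z i s) j z)) end.
  have fE (w : asg (csum X E) M) :
      vjoin (dpart j (rgt w)) (cpart j (rgt w)) = (fun s z => w s (f s z)).
    by apply: functional_extensionality_dep => s; apply/funext => -[].
  by rewrite !fE; exact: eqtp_sub.
have ok_div u : ok u -> exists j, sat (delta j) (vjoin b (dpart j (rgt u))).
  move=> [/eqtp_sym ue ab].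
  (* Moving [u] to [(a,e)] sends [b] to some [b'] with the type of [b] over [Aa]. This [b']
     satisfies some disjunct; moving back, [b] satisfies the corresponding instance from [u]. *)
  have [b' ub] := eqtp_move s0 cpt small_adjoin b As (finite_csum Xf Ef) Yf ue.
  have [j dj] : exists j, sat (delta j) (vjoin b' (d j)).
    apply: phid; apply: tphi; apply/realizesE/eqtp_adjoinE.
    pose f s (z : csum Y X s) : csum (csum X E) Y s :=
      match z with inl y => inr y | inr x => inl (inl x) end.
    have fE (w : asg (csum X E) M) (y : asg Y M) :
        vjoin y (lft w) = (fun s z => vjoin w y s (f s z)).
      by apply: functional_extensionality_dep => s; apply/funext => -[].
    have ub' : eqtp A (vjoin b (lft u)) (vjoin b' a).
      have := @eqtp_sub _ M A (csum Y X) _ f _ _ ub.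
      by rewrite -(fE u b) -(fE (vjoin a e) b').
    apply: eqtp_trans ub'.
    pose g s (z : csum Y X s) : csum X Y s := match z with inl y => inr y | inr x =>
        inl x end.
    have gE (x : asg X M) (y : asg Y M) : vjoin y x = (fun s z => vjoin x y s (g s z)).
      by apply: functional_extensionality_dep => s; apply/funext => -[].
    by rewrite !gE; exact: eqtp_sub.
  exists j.
  apply: (eqtp_sym ub (P := fun w => sat (delta j) (vjoin (rgt w) (dpart j (rgt (lft
      w)))))) => //.
  exact: (pdefinable_delta _ _ (U := csum (csum X E) Y) (fun s => inr)
    (fun s y => inl (inr (inl (existT (fun i => Yd i s) j y))))).
have chains n : exists l, size l = n /\ indep_chain ok A l.
  elim: n => [|n [l [ln cl]]]; first by exists [::].
  have [D [Ds AbD lD]] := small_cover l (finite_csum Xf Ef) (small_adjoin (c := b) Yf As).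
  have AD s : @A s `<=` @D s by move=> m Am; apply: AbD; left.
  have [a' [aa' av]] := nonforking_avoids s0 cpt Ds Xf AbD nf.
  have aa : eqtp A a a' by apply: eqtp_mono aa'; left.
  have [e1 ae1] := eqtp_move s0 cpt small_adjoin e As Xf Ef aa.
  pose A1 := adjoin A a'.
  have A1s : small K A1 by exact: small_adjoin.
  have D1s : small K (adjoin D a') by exact: small_adjoin.
  have A1D s : A1 s `<=` adjoin D a' s.
    by move=> m [/AD|[x _ <-]]; [left|right; exists x].
  (* The type of [e1] is extended from its own domain [Aa'], where rosiness excludes forking. *)
  have nf1 := rosy_nonforking s0 cpt small_adjoin (e := e1) rM A1s Ef.
  have [e' [ee' av']] := nonforking_avoids s0 cpt D1s Ef A1D nf1.
  have oku : ok (vjoin a' e').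
    split; last exact/eqtp_adjoinE.
    apply: eqtp_trans ae1 _.
    move/eqtp_adjoinE: ee'.
    pose g s (z : csum X E s) : csum E X s := match z with inl y => inr y | inr x =>
        inl x end.
    have gE (x : asg X M) (y : asg E M) : vjoin x y = (fun s z => vjoin y x s (g s z)).
      by apply: functional_extensionality_dep => s; apply/funext => -[].
    by rewrite !gE; exact: eqtp_sub.
  exists (vjoin a' e' :: l); split; first by rewrite /= ln.
  split=> // [j|].
    apply: (nonalg_eqtp s0 (Ydf j) (dcpart _ _ j (proj1 oku))).
    by have [_ []] := H j.
  (* The earlier links stay a chain over [a'] and [e'] by two applications of [indep_chain_adjoin],
     each with the empty tuple as initial [w]. *)
  rewrite -adjoin_vjoin -/A1 -(adjoin_nil A1).
  apply: (indep_chain_adjoin s0 cpt small_adjoin Xf Ef Ydf Zf (D := adjoin D a')) => //.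
  - exact: finite_cnil.
  - by move=> u ul s y; left; exact: lD.
  rewrite adjoin_nil /A1 -(adjoin_nil A).
  apply: (indep_chain_adjoin s0 cpt small_adjoin Xf Ef Ydf Zf (D := D)) => //.
  - exact: finite_cnil.
  - by rewrite adjoin_nil.
apply: (rosy_not_rich s0 Yf Ydf Zf dPi cpt small_adjoin rM As) => n N.
(* The head of the chain becomes the root of the tree: its parameters are non-algebraic over [B],
   and the tail is a chain over [B] together with the head. *)
suff main l B (P : asg Y M -> Prop) : (forall s, @A s `<=` @B s) -> indep_chain ok B l ->
    pdefinable B P -> P b -> tree delta Pi k (fun _ => True) (size l) N P.
  have [l [<- cl]] := chains n.
  by apply: (main _ A) => // [s m //|]; exact: (pdefinable_cst s0).
elim: l B P => [|u l IH] B P AB; first by move=> _ _ Pb; exists b.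
move=> [oku nu cl] dP' Pb.
have [j dj] := ok_div u oku.
have [_ [Pej kcj _]] := H j.
have euj := dcpart _ _ j (proj1 oku).
have Pu : Pi j (dpart j (rgt u)) (cpart j (rgt u)).
  exact: (euj (fun w => Pi j (lft w) (rgt w))).
have ku : k_inconsistent (k j) (delta j) (fun y => Pi j y (cpart j (rgt u))).
  apply: (euj (fun w => k_inconsistent (k j) (delta j) (fun y => Pi j y (rgt w)))) => //.
  exact: (pdefinable_kincPi s0 delta k Yf Ydf dPi (U := csum (Yd j) (Z j)) (fun s => inr)
    (fun s m h => h)).
apply: (tree_nonalg s0 Yf Ydf Zf dPi AB dP' _ ku Pu (nu j)) => //.
apply: (IH (adjoin B u)) => //.
  by move=> s m /AB; left.
apply: pdefinable_and; first exact: pdefinable_mono (@adjoin_sub _ _ B _ u) dP'.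
apply: (@pdefinable_inst_adjoin _ M B Y _ u (fun x w => sat (delta j) (vjoin x (dpart j
    (rgt w))))).
exact: (pdefinable_delta _ _ (U := csum Y (csum X E)) (fun s => inl)
    (fun s y => inr (inr (inl (existT (fun i => Yd i s) j y))))).
Qed.

Lemma rosy_symmetric : rosy M -> thorn_symmetric M K.
Proof.
move=> rM X Y a b A Xf Yf As.
by split=> nf h; apply: nf; apply: rosy_fork_sym h.
Qed.

End RosySymmetric.

(** * Small parameter sets and saturation *)

Section Cardinals.

(* A maximal family of disjoint sequences covers all but finitely many points. *)
Lemma infinite_prod_nat_inj T : infinite_set [set: T] ->
  exists f : T * nat -> T, injective f.
Proof.
move=> Tinf.
have [E [ED Etriv Emax]] :=
  ex_maximal_disjoint_subcollection (fun f : nat -> T => range f) [set f | injective f].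
pose U := \bigcup_(f in E) range f.
have Rfin : finite_set (~` U).
  apply: contrapT => /infiniteP/card_leE[g gi].
  pose g' n := sval (g (exist _ n Logic.I)).
  have g'i : injective g'.
    by move=> m n /sval_inj/gi/(congr1 sval).
  have g'U n : ~ U (g' n) by exact: (svalP (g (exist _ n Logic.I))).
  apply: (Emax (E `|` [set g'])).
  - split=> [f Ef|]; first by left.
    move=> /(_ g' (or_intror erefl)) Eg.
    by apply: (g'U 0); exists g' => //; exists 0.
  - by move=> f [/ED|->].
  - move=> f h [Ef|->] [Eh|->] // [x [[m mT xm] [n nT xn]]].
    + by apply: Etriv => //; exists x; split; [exists m|exists n].
    + by case: (g'U n); rewrite xn -xm; exists f => //; exists m.
    + by case: (g'U m); rewrite xm -xn; exists h => //; exists n.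
have [f0 Ef0] : exists f0, E f0.
  apply: contrapT => nE; apply: Tinf; rewrite (_ : setT = ~` U) //.
  by apply/seteqP; split=> // x _ [f Ef _]; apply: nE; exists f.
have [code codei] : exists code : T -> nat, {in ~` U &, injective code}.
  exact/countable_injP/finite_set_countable.
(* Points covered by a sequence get even positions; the finitely many others are coded at odd
   positions of one sequence [f0]. *)
have H t : exists p : {f | E f} * nat, if pselect (U t) then sval p.1 (p.2./2) = t /\
    ~~ odd p.2
    else p = (exist _ f0 Ef0, (code t).*2.+1).
  case: pselect => [[f Ef [n nT fn]]|nU]; last by eexists.
  by exists (exist _ f Ef, n.*2); rewrite /= doubleK odd_double.
have [al alP] := dep_choice H.
have ali : injective al.
  move=> s t E'; have := alP s; have := alP t; rewrite -E'.
  case: pselect => Ut; case: pselect => Us.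
  - by move=> [E1 _] [E2 _]; exact: etrans (esym E2) E1.
  - by move=> [_ o] E2; move: o; rewrite E2 /= odd_double.
  - by move=> -> [_]; rewrite /= odd_double.
  by move=> -> [/double_inj/codei]; rewrite !inE => ->.
(* The position in a sequence and the given natural number are paired into a new position of the
   same sequence. *)
exists (fun p => let q := al p.1 in sval q.1 (pickle (q.2, p.2))).
move=> [s m] [t n] /=.
case Es : (al s) => [[f Ef] i]; case Et : (al t) => [[g Eg] j] /= E'.
have fg : f = g.
  apply: Etriv => //; exists (f (pickle (i, m))); split; first by exists (pickle (i, m)).
  by rewrite E'; exists (pickle (j, n)).
subst g; have /(pcan_inj pickleK)[ij ->] := ED f Ef _ _ E'.
congr pair; apply: ali; rewrite Es Et ij; congr (_, _); exact: eq_exist.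
Qed.

(** An infinite [T] absorbs the factor [nat], and for finite [T] the product is countable; either
    way [K] would inject into [T] or into [nat]. *)
Lemma not_inj_prod_nat (K T U : Type) (h : U -> T * nat) : injective h ->
  (~ exists f : K -> T, injective f) -> (~ exists f : K -> nat, injective f) ->
  ~ exists f : K -> U, injective f.
Proof.
move=> hi nT nN [f fi].
have [Tfin|/infinite_prod_nat_inj[g gi]] := pselect (finite_set [set: T]).
  have [c ci] : exists c : T -> nat, {in [set: T] &, injective c}.
    exact/countable_injP/finite_set_countable.
  apply: nN; exists (fun x => let p := h (f x) in pickle (c p.1, p.2)).
  move=> x y /(pcan_inj pickleK)[E1 E2]; apply: fi; apply: hi.
  move: E1 E2; case: (h (f x)) (h (f y)) => [s m] [t n] /= /ci; rewrite !inE.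
  by move=> /(_ Logic.I Logic.I) -> ->.
by apply: nT; exists (g \o h \o f) => x y /gi/hi/fi.
Qed.

Variables (S : signature) (M : structure S) (K : Type).
Hypothesis Kunc : card_lt [set: nat] [set: K].

Lemma card_ltE T (A : set T) :
  card_lt A [set: K] <-> ~ exists f : K -> {x | A x}, injective f.
Proof.
rewrite /card_lt card_leE; split=> H [f fi]; apply: H.
  exists (fun k => f (sval k)) => -[x []] [y []] /fi /= ->.
  by [].
by exists (fun k => f (exist _ k Logic.I)) => x y /fi/(congr1 sval).
Qed.

Let Knat : ~ exists f : K -> nat, injective f.
Proof.
have := Kunc; rewrite card_ltE => H [f fi]; apply: H.
by exists (fun k => exist _ (f k) Logic.I) => x y /(congr1 sval)/fi.
Qed.

Lemma card_lt_prod_nat T U (A : set T) (B : set U) (h : {y | B y} -> {x | A x} * nat) :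
  injective h -> card_lt A [set: K] -> card_lt B [set: K].
Proof. by move=> hi /card_ltE nA; apply/card_ltE; exact: not_inj_prod_nat hi nA Knat. Qed.

Lemma small_countable (A : pset M) : countable (elements A) -> small K A.
Proof. by move=> Ac KA; apply: Kunc; exact: card_le_trans KA Ac. Qed.

(** An old element is coded with [0], a new one by a positive code of its variable, paired with a
    dummy element [a] of [A]; for empty [A] the result is countable. *)
Lemma small_adjoin (A : pset M) Z (c : asg Z M) :
  finite_ctx Z -> small K A -> small K (adjoin A c).
Proof.
move=> Zf As.
have [[a Aa]|nA] := pselect (exists a, elements A a); last first.
  apply: small_countable; apply: elements_adjoin_countable => //.
  rewrite (_ : elements A = set0) //.
  by apply/seteqP; split=> // x Ax; apply: nA; exists x.
have [code codei] : exists code : {s & Z s} -> nat, {in [set: {s & Z s}] &, injective code}.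
  exact/countable_injP/finite_set_countable.
have H (p : {p | elements (adjoin A c) p}) : exists q : {p | elements A p} * nat,
    (q.2 = 0 /\ sval q.1 = sval p) \/ (exists z, q.2 = (code z).+1 /\
      existT _ (projT1 z) (c _ (projT2 z)) = sval p /\ sval q.1 = a).
  case: p => [[s m] mA]; case: (mA) => [Am|[z zT zm]].
    by exists (exist _ (existT _ s m) Am, 0); left.
  exists (exist _ a Aa, (code (existT _ s z)).+1); right; exists (existT _ s z).
  by rewrite /=; split=> //; split=> //; congr existT.
have [h hP] := dep_choice H.
apply: (card_lt_prod_nat (h := h)) As => p q E; apply: sval_inj.
have := hP p; have := hP q; rewrite E.
case=> [[n0 <-]|[z [nz [<- _]]]] [[n0' <-]|[z' [nz' [<- _]]]] //.
- by move: nz'; rewrite n0.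
- by move: n0'; rewrite nz.
by move: nz'; rewrite nz => -[/codei]; rewrite !inE => /(_ Logic.I Logic.I) ->.
Qed.

Lemma saturated_compact : saturated M K -> compact_model M K.
Proof.
move=> sat B X G Bs Xf dG [P0 GP0] dir con.
pose p : set (form (csum X (params B))) := [set phi | exists P, G P /\
  forall x, P x <-> Defs.sat phi (vjoin x (@pval S M B))].
have dirn r (P : 'I_r -> asg X M -> Prop) : (forall j, G (P j)) ->
    exists R, G R /\ forall j x, R x -> P j x.
  elim: r P => [|r IH] P GP; first by exists P0; split=> // -[].
  have [R [GR RP]] := IH (fun j => P (lift ord0 j)) (fun j => GP _).
  have [T [GT TP]] := dir _ _ (GP ord0) GR.
  exists T; split=> // j x /TP[P0x /RP Rx].
  by case: (unliftP ord0 j) => [i|] ->.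
have [|x xp] := sat B X p Bs Xf.
  move=> q /finite_set_enum[r [d dP]] qp.
  have [P PP] : exists P : 'I_r -> asg X M -> Prop, forall j, G (P j) /\
      (q (d j) -> forall x, P j x -> Defs.sat (d j) (vjoin x (@pval S M B))).
    apply: (dep_choice (P := fun j P => G P /\ (q (d j) -> forall x, P x -> _))) => j.
    (* The enumeration [d] may leave [q]; [P0] is the default there. *)
    have [/qp[P [GP H]]|nq] := pselect (q (d j)); last by exists P0.
    by exists P; split=> // _ x /H.
  have [R [GR RP]] : exists R, G R /\ forall j x, R x -> P j x.
    by apply: dirn => j; have [] := PP j.
  have [x Rx] := con _ GR; exists x => phi qphi; have [j E] := dP _ qphi.
  by rewrite -E; have [_] := PP j; apply; [rewrite E|exact: RP].
exists x => P GP; have /pdefinable_formP[phi phiE] := dG _ GP.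
by apply/phiE; apply: xp; exists P.
Qed.

End Cardinals.

(** * Compactness of the imaginary expansion *)

Section Eq.
Variables (L : language) (C : structure L).
Let S := eqsig C.
Let M : structure S := eqstructure C.
Let pt : sorts L := tt.

(* An element of [C^eq] is coded by a tuple of elements of [C] in its class,
   a variable of sort [s] by one home variable for each [i : repidx s]. *)
Definition repidx (s : sorts S) : Type :=
  match s with Home => unit | Quot E => 'I_(eqarity E) end.

Definition repval (s : sorts S) : (repidx s -> C tt) -> M s :=
  match s return (repidx s -> C tt) -> M s with
  | Home => fun u => u tt
  | Quot E => fun u => toclass u
  end.

Definition repctx (V : ctx S) : ctx L := fun _ => {s : sorts S & (V s * repidx s)%type}.

Definition repasg (V : ctx S) (u : asg (repctx V) C) : asg V M :=
  fun s v => repval (fun i => u pt (existT (fun s => (V s * repidx s)%type) s (v, i))).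

Lemma finite_repidx s : finite_set [set: repidx s].
Proof. case: s => [|E] /=; exact: finite_finset. Qed.

Lemma finite_repctx V : finite_ctx V -> finite_ctx (repctx V).
Proof.
move=> Vf; have H : finite_set [set: {p : {s & V s} & repidx (projT1 p)}].
  by apply: finite_type_sigT => // p; exact: finite_repidx.
apply: (finite_type_surj (f := fun p : {p : {s & V s} & repidx (projT1 p)} =>
  existT (repctx V) pt (existT (fun s => (V s * repidx s)%type)
    (projT1 (projT1 p)) (projT2 (projT1 p), projT2 p)))) H.
by case=> [[] [s [v i]]]; exists (existT (fun p : {s & V s} => repidx (projT1 p))
    (existT _ s v) i).
Qed.

Lemma repval_surj s (m : M s) : exists u, repval (s := s) u = m.
Proof.
case: s m => [|E] m; first by exists (fun _ => m).
case: m => Q [a Qa] /=; exists a; apply: eq_exist; exact: esym.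
Qed.

Lemma repasg_surj V (v : asg V M) : exists u, repasg u = v.
Proof.
have /dep_choice[f fP] : forall p : {s & V s}, exists u, repval (s := projT1 p) u = v _
    (projT2 p).
  by move=> p; exact: repval_surj.
exists (fun t p => match t return C t with
  tt => f (existT _ (projT1 p) (projT2 p).1) (projT2 p).2 end).
by apply: functional_extensionality_dep => s; apply/funext => x; exact: (fP (existT _ s x)).
Qed.

(** Function symbols only take arguments of the home sort, so a compound term is represented by an
    [L]-term or, under a projection, by the tuple of its arguments. *)
Lemma rep_term V s (t : term V s) : exists ts : repidx s -> term (repctx V) pt,
  forall u : asg (repctx V) C, eval (repasg u) t = repval (fun i => eval u (ts i)).
Proof.
elim: t => [s' x|f args IH].
  by exists (fun i => Var (V := repctx V) (s := pt) (existT (fun s => (V s * repidx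
      s)%type) s' (x, i))).
case: f args IH => [g|E] args /= /dep_choice[ts tsP].
  exists (fun _ => @App L (repctx V) (g : Defs.fsym L) (fun i => ts i tt)) => u /=.
  congr (@ifunc L C g _); apply: functional_extensionality_dep => i; exact: tsP.
exists (fun i => ts i tt) => u /=; congr toclass.
by apply/funext => i; exact: tsP.
Qed.

Lemma toclass_eqE (E : eqformula C) (a b : 'I_(eqarity E) -> C tt) :
  toclass a = toclass b <-> tuplerel (eqform E) a b.
Proof.
split=> [/(congr1 sval) /= E'|ab].
  have : [set c | tuplerel (eqform E) b c] b by exact: eqf_refl.
  by rewrite -E'.
apply: eq_exist; apply/seteqP; split=> c /= h.
  by apply: eqf_trans h; exact: eqf_sym.
exact: eqf_trans h.
Qed.

Lemma definable_rep_eq V s (ts us : repidx s -> term (repctx V) pt) :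
  definable (fun u : asg (repctx V) C =>
    repval (fun i => eval u (ts i)) = repval (fun i => eval u (us i))).
Proof.
case: s ts us => [|E] ts us /=; first by exists (FEq (ts tt) (us tt)).
pose n := eqarity E.
have nf : finite_ctx (@pairctx L n).
  apply: finite_csum; apply: (finite_type_surj (f := fun i : 'I_n => existT (fun _ :
      sorts L => 'I_n) pt i));
  by [case=> [[] i]; exists i|exact: finite_type_ord].
(* The terms are inserted into [eqform E] by quantifying over variables equal to them. *)
pose P (u : asg (repctx V) C) (w : asg (@pairctx L n) C) :=
  (forall i, w pt (inl i) = eval u (ts i)) /\ ((forall i, w pt (inr i) = eval u (us i)) /\
   sat (eqform E) w).
apply: (@definable_ext _ _ _ (fun u => exists w, P u w)).
  move=> u; rewrite toclass_eqE; split=> [[w [wt [wu Ew]]]|h].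
    rewrite /tuplerel; move: Ew; congr sat.
    apply: functional_extensionality_dep => -[]; apply/funext => -[i|i] /=.
      by rewrite -wt.
    by rewrite -wu.
  by eexists; split; [|split]; last exact: h.
have lin (t : term (repctx V) pt) (x : @pairctx L n pt) :
    definable (fun v : asg (csum (repctx V) (@pairctx L n)) C => v pt (inr x) = eval
        (lft v) t).
  exists (FEq (Var (V := csum (repctx V) (@pairctx L n)) (s := pt) (inr x))
     (rename_term (fun s => inl) t)) => v /=.
  by rewrite eval_rename.
apply: definable_ex => //; apply: definable_and.
  by apply: (definable_all pt) => [|i]; [exact: finite_type_ord|exact: lin].
apply: definable_and.
  by apply: (definable_all pt) => [|i]; [exact: finite_type_ord|exact: lin].
by apply: (definable_sub (fun s => inr)); exists (eqform E).
Qed.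

(** A quantifier over a quotient sort becomes one over representative tuples, as every class has a
    representative; relation symbols concern the home sort only. *)
Lemma definable_rep V (phi : form V) :
  definable (fun u : asg (repctx V) C => sat phi (repasg u)).
Proof.
elim: phi => {V} V.
- move=> s t t' /=; have [ts tsP] := rep_term t; have [us usP] := rep_term t'.
  by apply: definable_ext (definable_rep_eq ts us) => u; rewrite tsP usP.
- move=> R args; have /dep_choice[ts tsP] := fun i => rep_term (args i).
  exists (@FRel L _ (R : Defs.rsym L) (fun i => ts i tt)) => u /=.
  rewrite (_ : (fun i => eval (repasg u) (args i)) = (fun i => eval u (ts i tt))) //.
  by apply: functional_extensionality_dep => i; exact: tsP.
- by move=> p IH; exact: definable_not.
- by move=> p IHp q IHq; exact: definable_and.
move=> s p IH /=.
pose W : ctx L := fun _ => repidx s.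
have Wf : finite_ctx W.
  apply: (finite_type_surj (f := fun i : repidx s => existT W pt i)).
    by case=> [[] i]; exists i.
  exact: finite_repidx.
pose r : ctx_map (repctx (cext V s)) (csum (repctx V) W) := fun _ z =>
  match z with existT t (x, i) => match x with
    | inl v => fun i => inl (existT (fun s => (V s * repidx s)%type) t (v, i))
    | inr e => fun i => inr (eq_rect_r repidx i e) end i end.
pose P u (w : asg W C) := sat p (repasg (fun q z => vjoin u w q (r q z))).
apply: (@definable_ext _ _ _ (fun u => exists w, P u w)).
  have E u (w : asg W C) : repasg (fun q z => vjoin u w q (r q z)) =
      vext (repasg u) (repval (w pt)).
    apply: functional_extensionality_dep => t; apply/funext => -[v|e] //=.
    by subst t.
  move=> u; split=> [[w]|[m]]; rewrite /P ?E.
    by exists (repval (w pt)).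
  have [w <-] := repval_surj m => h; exists (fun t i => match t return C t with tt => w
      i end).
  by rewrite E.
apply: definable_ex => //.
apply: definable_ext (definable_sub r IH) => v.
by rewrite /P vjoinK.
Qed.

Variable K : Type.
Hypothesis Kunc : card_lt [set: nat] [set: K].

(** The family is pulled back along [repasg] to a family of relations on [C]; a point common to the
    latter maps to a point common to the former. *)
Lemma eqstructure_compact : saturated C K -> compact_model M K.
Proof.
move=> /saturated_compact cptC B X G Bs Xf dG [P0 GP0] dir con.
have /dep_choice[rho rhoP] : forall p : {s & params B s}, exists u : repidx (projT1 p)
    -> C tt,
    repval u = sval (projT2 p).
  by move=> p; exact: repval_surj.
(* Each parameter is replaced by the finitely many entries of a chosen representative, so [B'] stays
   small. *)
pose B' : pset C := fun t m => exists p i, m = match t return C t with tt => rho p i end.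
have B's : small K B'.
  have code s : exists c : repidx s -> nat, injective c.
    have /finite_set_countable/countable_injP[c ci] := finite_repidx s.
    by exists c => i j /ci; rewrite !inE; apply.
  have {code}[code codei] := dep_choice code.
  pose flat (p : {s & params B s}) : {s & M s} := existT _ (projT1 p) (sval (projT2 p)).
  have flati : injective flat.
    move=> [s p] [t q] E; have Est : s = t by case: E.
    by subst t; congr existT; apply: sval_inj; exact: existT_inj E.
  have H (x : {x | elements B' x}) : exists q : {x | elements B x} * nat,
      exists p i, [/\ sval x = existT _ pt (rho p i), sval q.1 = flat p & q.2 = code _ i].
    case: x => [[[] m] mB]; case: (mB) => p [i /= mi].
    have Bp : elements B (flat p) by exact: svalP (projT2 p).
    by exists (exist _ (flat p) Bp, code _ i), p, i; split=> //=; rewrite mi.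
  have [h hP] := dep_choice H.
  apply: (card_lt_prod_nat Kunc (h := h)) Bs => x y E; apply: sval_inj.
  have [p [i [-> xp xi]]] := hP x; have [q [j [-> yq yj]]] := hP y.
  have pq : p = q by apply: flati; rewrite -xp -yq E.
  subst q; have -> // : i = j by apply: codei; rewrite -xi -yj E.
pose rp s (p : params B s) i : params B' pt :=
  exist _ (rho (existT _ s p) i) (ex_intro _ (existT _ s p) (ex_intro _ i erefl)).
pose dn (P : asg X M -> Prop) (x : asg (repctx X) C) := P (repasg x).
have dndef P : G P -> pdefinable B' (dn P).
  move=> /dG[Q [[phi phiE] PQ]].
  pose r : ctx_map (repctx (csum X (params B))) (csum (repctx X) (params B')) := fun t z =>
    match t, z with tt, existT s (y, i) => match y with
      | inl x => fun i => inl (existT (fun s => (X s * repidx s)%type) s (x, i))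
      | inr p => fun i => inr (rp s p i) end i end.
  exists (fun u => sat phi (repasg (fun t z => u t (r t z)))).
  split; first exact: (definable_sub r (definable_rep phi)).
  move=> x; rewrite /dn PQ -phiE.
  suff -> : vjoin (repasg x) (@pval _ M B) =
    repasg (fun t z => vjoin x (@pval _ C B') t (r t z)) by [].
  apply: functional_extensionality_dep => s; apply/funext => -[y|p] //=.
  by rewrite /repasg /= (rhoP (existT _ s p)).
have [||||x xP] := cptC B' (repctx X) (fun Q => exists P, G P /\ Q = dn P) B's
    (finite_repctx Xf).
- by move=> _ [P [GP ->]]; exact: dndef.
- by exists (dn P0), P0.
- move=> _ _ [P [GP ->]] [Q [GQ ->]]; have [R [GR RPQ]] := dir _ _ GP GQ.
  by exists (dn R); split; [exists R|move=> x /RPQ].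
- by move=> _ [P [GP ->]]; have [x Px] := con _ GP; have [y yx] := repasg_surj x;
    exists y; rewrite /dn yx.
by exists (repasg x) => P GP; apply: (xP (dn P)); exists P.
Qed.

End Eq.

Theorem theorem2p1p2 (L : language) (T : set (sentence L)) (K : Type)
    (C : structure L) (hC : monster T K C) :
  rosy (eqstructure C) <-> thorn_symmetric (eqstructure C) K.
Proof.
have [_ [Kunc _ _] satC _] := hC.
have cpt := eqstructure_compact Kunc satC.
have adj := @small_adjoin _ (eqstructure C) K Kunc.
pose s0 : sorts (eqsig C) := Home C.
split; first exact: (rosy_symmetric s0 cpt adj).
exact: (symmetric_rosy s0 cpt adj (small_countable Kunc)).
Qed.
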